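(* For $n\ge 2$, the characteristic polynomial $\chi(\Pi_{B_n}^{(2)},t)$ equals $$\sum_{m=0}^{\lfloor n/2\rfloor}\binom{n}{2m}\frac{(4m)!}{2^{2m}(2m+1)!}\,(-t)^m\prod_{\substack{1\le a\le n-2m-2\\ a\equiv n \bmod 2}}(1-4a^2t).$$
   Context: $W(B_n)=\{\pm1\}^n\rtimes S_n$ is the Coxeter group of signed permutations acting on $\mathbb{R}^n$. $\Pi_{B_n}^{(2)}$ is the poset, under inclusion, of parabolic subgroups of $W(B_n)$ (pointwise stabilizers of subspaces of $\mathbb{R}^n$) all of whose irreducible components have even rank; its minimum $\hat 0$ is the trivial subgroup. Its characteristic polynomial is $$\chi(\Pi_{B_n}^{(2)},t)=\sum_{W'\in\Pi_{B_n}^{(2)}}\mu(\hat 0,W')\,t^{\mathrm{rk}(W')/2},$$ where $\mu$ is the Möbius function of the poset $\Pi_{B_n}^{(2)}$ and $\mathrm{rk}(W')$ is the rank of $W'$ as a Coxeter group. An empty product is $1$. *)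

(* Defs.v *)
From HB Require Import structures.
From mathcomp Require Import all_boot all_order all_algebra all_fingroup.
From mathcomp Require Import boolp reals.

Set Implicit Arguments.
Unset Strict Implicit.
Unset Printing Implicit Defensive.

Import Order.TTheory GroupScope GRing.Theory Num.Theory.
Local Open Scope ring_scope.

(* W(B_n) = {+-1}^n ><| S_n.  The pair (e, s) stands for the signed           *)
(* permutation sending the i-th basis vector to (-1)^(e i) times the          *)
(* (s i)-th one.  As in perm.v, products compose from left to right, so that  *)
(* the group acts on the right of row vectors (signed_mxM below).             *)
Definition signed_perm (n : nat) : Type := ({ffun 'I_n -> bool} * 'S_n)%type.

HB.instance Definition _ n := Finite.on (signed_perm n).

Definition signed_mul n (u v : signed_perm n) : signed_perm n :=
  ([ffun i => u.1 i (+) v.1 (u.2 i)], (u.2 * v.2)%g).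
Definition signed_one n : signed_perm n := ([ffun=> false], 1%g).
Definition signed_inv n (u : signed_perm n) : signed_perm n :=
  ([ffun i => u.1 ((u.2)^-1%g i)], (u.2)^-1%g).

Lemma signed_mulA n : associative (@signed_mul n).
Proof.
move=> u v w; rewrite /signed_mul /= mulgA; congr (_, _).
by apply/ffunP => i; rewrite !ffunE permM addbA.
Qed.

Lemma signed_mul1 n : left_id (@signed_one n) (@signed_mul n).
Proof.
move=> [e s]; rewrite /signed_mul /= mul1g; congr (_, _).
by apply/ffunP => i; rewrite !ffunE perm1.
Qed.

Lemma signed_mulV n : left_inverse (@signed_one n) (@signed_inv n) (@signed_mul n).
Proof.
move=> [e s]; rewrite /signed_mul /signed_one /= mulVg; congr (_, _).
by apply/ffunP => i; rewrite !ffunE addbb.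
Qed.

HB.instance Definition _ n := Finite_isGroup.Build (signed_perm n)
  (@signed_mulA n) (@signed_mul1 n) (@signed_mulV n).

Definition signed_mx (R : nzRingType) n (w : signed_perm n) : 'M[R]_n :=
  diag_mx (\row_i (-1) ^+ w.1 i) *m perm_mx w.2.

Lemma signed_mxM (R : nzRingType) n (u v : signed_perm n) :
  signed_mx R (u * v)%g = signed_mx R u *m signed_mx R v.
Proof.
apply/row_matrixP => i; apply/rowP => j.
rewrite !mxE (bigD1 i) //= big1 ?addr0 => [|k]; last first.
  by rewrite !mxE eq_sym => /negPf->; rewrite mulr0n mul0r.
rewrite (bigD1 (u.2 i)) //= big1 ?addr0 => [|k ki]; last first.
  rewrite [signed_mx R u i k]mxE big1 ?mul0r // => l _; rewrite !mxE.
  by case: eqP => [<-|]; rewrite ?mul0r // eq_sym (negPf ki) mulr0.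
rewrite ![signed_mx R _ _ _]mxE (bigD1 i) //= big1 ?addr0 => [|k]; last first.
  by rewrite !mxE eq_sym => /negPf->; rewrite mulr0n mul0r.
rewrite (bigD1 (u.2 i)) //= big1 ?addr0 => [|k]; last first.
  by rewrite !mxE eq_sym => /negPf->; rewrite mulr0n mul0r.
by rewrite !mxE !eqxx !mulr1n ffunE permM mulr1 signr_addb mulrA.
Qed.

Definition pointwise_stabilizer (R : realType) n (U : {vspace 'rV[R]_n}) :
    {set signed_perm n} :=
  [set w | `[< forall v, v \in U -> v *m signed_mx R w = v >]].

Definition parabolic (R : realType) n (H : {group signed_perm n}) : Prop :=
  exists U : {vspace 'rV[R]_n}, H :=: pointwise_stabilizer U.

(* The simple reflections of W(B_n): the sign change of the first coordinate  *)
(* and the transpositions of two adjacent coordinates.                        *)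
Definition sign_change n (i : 'I_n) : signed_perm n :=
  ([ffun j => j == i], 1%g).
Definition transposition n (i j : 'I_n) : signed_perm n :=
  ([ffun=> false], tperm i j).
Definition simple_reflections n : {set signed_perm n} :=
  [set sign_change i | i : 'I_n & (i == 0 :> nat)%N] :|:
  [set transposition p.1 p.2
     | p : 'I_n * 'I_n & (p.2 == p.1.+1 :> nat)%N].

(* A parabolic subgroup is a conjugate of the subgroup generated by a set I   *)
(* of simple reflections (Steinberg); its Coxeter generators are the          *)
(* corresponding conjugates of the elements of I.  An abstract Coxeter        *)
(* presentation of the subgroup would not do: W(B_3), irreducible of rank 3,  *)
(* is isomorphic to the group of type A_1 x A_3.                              *)
Definition coxeter_generating n (H S : {set signed_perm n}) : bool :=
  (<<S>> == H) &&
  [exists w : signed_perm n, exists I : {set signed_perm n},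
     (I \subset simple_reflections n) && (S == I :^ w)%g].

(* By Steinberg's theorem the default value is not used on parabolic          *)
(* subgroups; other choices of generators give isomorphic Coxeter systems.    *)
Definition coxeter_generators n (H : {set signed_perm n}) :
    {set signed_perm n} :=
  odflt set0 [pick S | coxeter_generating H S].

Definition coxeter_rank n (H : {set signed_perm n}) : nat :=
  #|coxeter_generators H|.

(* Adjacency in the Coxeter graph on S: the order m(s, t) of s t is at least  *)
(* 3.                                                                         *)
Definition coxeter_edge (gT : finGroupType) (S : {set gT}) : rel gT :=
  [rel s t | [&& s \in S, t \in S & (2 < #[s * t]%g)%N]].

(* An irreducible component of H is generated by a connected component C of   *)
(* the Coxeter graph, and its rank is #|C|.                                   *)
Definition irreducible_components n (H : {set signed_perm n}) :
    {set {set signed_perm n}} :=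
  let S := coxeter_generators H in
  equivalence_partition (connect (coxeter_edge S)) S.

(* The poset Pi_{B_n}^{(2)}, ordered by inclusion.                            *)
Definition PiB2 (R : realType) n : {set {group signed_perm n}} :=
  [set H | `[< parabolic R H >] &
     [forall C in irreducible_components H, ~~ odd #|C|]].

(* The Moebius function of the finite poset (P, le): mu(x, x) = 1 and         *)
(* mu(x, y) = - sum_(x <= z < y) mu(x, z).  The argument k bounds the depth   *)
(* of the recursion; see mobius_refl and mobius_rec.                          *)
Fixpoint mobius_fuel (T : finType) (P : {set T}) (le : rel T) (k : nat)
    (x y : T) : int :=
  if x == y then 1 else
  if k is k'.+1 then
    - \sum_(z in P | [&& le x z, le z y & z != y]) mobius_fuel P le k' x z
  else 0.

Definition mobius (T : finType) (P : {set T}) (le : rel T) (x y : T) : int :=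
  mobius_fuel P le #|P| x y.

Lemma mobius_refl (T : finType) (P : {set T}) (le : rel T) (x : T) :
  mobius P le x x = 1.
Proof. by rewrite /mobius; case: #|P| => [|k] /=; rewrite eqxx. Qed.

Lemma mobius_rec (T : finType) (P : {set T}) (le : rel T) (x y : T) :
  antisymmetric le -> transitive le -> y \in P -> x != y ->
  mobius P le x y =
    - \sum_(z in P | [&& le x z, le z y & z != y]) mobius P le x z.
Proof.
move=> le_anti le_tr.
pose D y := [set z in P | le z y & z != y].
have ltD z y' : z \in D y' -> (#|D z| < #|D y'|)%N.
  rewrite inE => /and3P[zP zy nzy]; apply: proper_card; apply/properP; split.
    apply/subsetP => t; rewrite !inE => /and3P[-> tz ntz].
    rewrite (le_tr _ _ _ tz zy) /=; apply: contraNneq nzy => ty.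
    by apply/eqP/le_anti; rewrite zy -ty tz.
  by exists z; rewrite !inE ?eqxx ?zP ?zy ?nzy ?andbF.
have stable k l y' : (#|D y'| < k)%N -> (#|D y'| < l)%N ->
    mobius_fuel P le k x y' = mobius_fuel P le l x y'.
  elim: k l y' => // k IHk [|l] y' // yk yl /=; case: ifP => // _.
  congr (- _); apply: eq_bigr => z /andP[zP /and3P[_ zy nzy]].
  have zD : (#|D z| < #|D y'|)%N by apply: ltD; rewrite inE zP zy.
  by apply: IHk; apply: leq_trans zD _.
have ltP y' : y' \in P -> (#|D y'| < #|P|)%N.
  move=> y'P; apply: proper_card; apply/properP; split.
    by apply/subsetP => z; rewrite inE => /and3P[].
  by exists y'; rewrite // inE eqxx !andbF.
move=> yP nxy; rewrite {1}/mobius (stable _ #|P|.+1) ?ltP //; last first.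
  exact: ltnW (ltP _ yP).
by rewrite /= (negPf nxy).
Qed.

Definition charpoly_PiB2 (R : realType) n : {poly rat} :=
  \sum_(H in PiB2 R n)
    (mobius (PiB2 R n) (fun K L => K \subset L) 1%G H)%:~R *:
      'X^((coxeter_rank H)./2).

(* Main.v *)
(* A parabolic subgroup of W(B_n) is the stabilizer of a coloring             *)
(* v : 'I_n -> int, so up to signs it is a zero block Z together with a       *)
(* partition of the complement of Z into signed blocks; it lies in            *)
(* Pi_{B_n}^{(2)} iff #|Z| is even and the other blocks are odd.  Sums over   *)
(* the subgroups below a given one obey the exponential formula.  As arcsinh  *)
(* is the compositional inverse of sinh, the Moebius function is the product, *)
(* over the blocks B, of the coefficient of x^#|B| / #|B|! in arcsinh x,      *)
(* times the coefficient of x^#|Z| / #|Z|! in                                 *)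
(*   1 / cosh (arcsinh (2 x) / 2) = sinh (arcsinh (2 x) / 2) / x.             *)
(* Hence the exponential generating function of the characteristic            *)
(* polynomials is this last series at x sqrt t times                          *)
(*   exp (arcsinh (2 x sqrt t) / (2 sqrt t)),                                 *)
(* whose coefficients satisfy e_(k+2) = (1 - 4 k^2 t) e_k.                    *)

From HB Require Import structures.
Require Import Defs.
From mathcomp Require Import all_boot all_order all_algebra all_fingroup.
From mathcomp Require Import cyclic boolp reals.
From mathcomp Require Import ring lra zify.

Set Implicit Arguments.
Unset Strict Implicit.
Unset Printing Implicit Defensive.

Import Order.TTheory GRing.Theory Num.Theory.
Local Open Scope ring_scope.

(** A parabolic subgroup is determined by the relations x_i = x_j and x_i = - x_j that hold on the
    subspace it fixes. These relations amount to a normalized triple (Z, P, e), and inclusion of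
    subgroups is inclusion of relations ([color_stabS], [parabolic_signed_partition],
    [signed_partition_inj]). Up to conjugacy the subgroup is standard, with components of rank |Z|
    and |B| - 1 for the blocks B of P; this gives its rank and the parity condition
    ([coxeter_rank_color], [irreducible_components_even]).

    Below a coloring v, a sum of product weights over signed partitions becomes a sum over Z and
    over set partitions of the complement, each block B counted with its number of admissible signs
    ([sum_signed_partitions]): 2^(|B|-1) inside the zero block of v, 1 inside another block, 0
    across blocks. With the coefficients of arcsinh as weights, the exponential formula
    [partition_sum_card] yields, on a nonzero block, a coefficient of exp (arcsinh x) = x + sqrt (1
    + x^2), which vanishes in odd degrees above 1. On the zero block, with u = arcsinh (2 x) / 2, it
    yields a coefficient of exp u / cosh u = 1 + tanh u, whose even part is 1. Hence the weights
    satisfy the recursion of the Moebius function ([sum_partition_mobius], [mobius_PiB2]).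

    The polynomial is the same kind of sum, with powers of t inserted, below the zero coloring,
    where every block lies in the zero block. It is the convolution of [sech_arcsinh], in closed
    form by [sech_arcsinhE], with [exp_arcsinh] at q = 4 t, a product by [exp_arcsinh_prod]. All
    identities between series come from linear differential equations. *)

(** * Hurwitz series *)

(* The n-th entry is the coefficient of [x ^ n / n!].                         *)
Definition hurwitz (R : comNzRingType) := nat -> R.

Section HurwitzRing.
Variable R : comNzRingType.
Implicit Types a b c : hurwitz R.

HB.instance Definition _ := gen_eqMixin (hurwitz R).
HB.instance Definition _ := gen_choiceMixin (hurwitz R).

Definition hadd a b : hurwitz R := fun k => a k + b k.
Definition hopp a : hurwitz R := fun k => - a k.
Definition hzero : hurwitz R := fun=> 0.
Definition hone : hurwitz R := fun k => (k == 0)%:R.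
Definition hmul a b : hurwitz R :=
  fun k => \sum_(i < k.+1) ('C(k, i))%:R * a i * b (k - i)%N.
Definition hderiv a : hurwitz R := fun k => a k.+1.

Lemma haddA : associative hadd.
Proof. by move=> a b c; apply/funext => k; rewrite /hadd addrA. Qed.
Lemma haddC : commutative hadd.
Proof. by move=> a b; apply/funext => k; rewrite /hadd addrC. Qed.
Lemma hadd0 : left_id hzero hadd.
Proof. by move=> a; apply/funext => k; rewrite /hadd add0r. Qed.
Lemma haddN : left_inverse hzero hopp hadd.
Proof. by move=> a; apply/funext => k; rewrite /hadd addNr. Qed.

HB.instance Definition _ := GRing.isZmodule.Build (hurwitz R)
  haddA haddC hadd0 haddN.

Lemma hmul_coef0 a b : hmul a b 0 = a 0 * b 0.
Proof. by rewrite /hmul big_ord1 bin0 mul1r. Qed.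

Lemma hderivM a b : hderiv (hmul a b) = hadd (hmul (hderiv a) b) (hmul a (hderiv b)).
Proof.
apply/funext => k; rewrite /hderiv /hadd /hmul.
rewrite big_ord_recl /= bin0 mul1r subn0.
under eq_bigr => i _ do rewrite /= /bump /= add1n binS natrD mulrDl mulrDl subSS.
rewrite big_split /= addrA addrC; congr (_ + _).
rewrite [in RHS]big_ord_recl /= bin0 mul1r subn0; congr (_ + _).
rewrite big_ord_recr /= bin_small // !mul0r addr0.
by apply: eq_bigr => i _; rewrite /bump /= add1n -subSn ?subSS.
Qed.

(** Induction through the Leibniz rule: coefficient k+1 of a series is coefficient k of its
    derivative. The same argument gives [hmulA]. *)
Lemma hmulC : commutative hmul.
Proof.
move=> a b; apply/funext => k; elim: k a b => [|k IHk] a b.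
  by rewrite !hmul_coef0 mulrC.
rewrite -[LHS]/(hderiv (hmul a b) k) -[RHS]/(hderiv (hmul b a) k) !hderivM /hadd.
by rewrite addrC IHk [X in _ + X]IHk.
Qed.

Lemma hmulDl : left_distributive hmul hadd.
Proof.
move=> a b c; apply/funext => k; rewrite /hmul /hadd -big_split /=.
by apply: eq_bigr => i _; rewrite mulrDr mulrDl.
Qed.

Lemma hmulA : associative hmul.
Proof.
move=> a b c; apply/funext => k; elim: k a b c => [|k IHk] a b c.
  by rewrite !hmul_coef0 mulrA.
rewrite -[LHS]/(hderiv (hmul a (hmul b c)) k).
rewrite -[RHS]/(hderiv (hmul (hmul a b) c) k) !hderivM hmulDl /hadd.
rewrite (hmulC a (fun _ => _)) hmulDl /hadd !IHk -addrA.
by congr (_ + (_ + _)); rewrite hmulC IHk.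
Qed.

Lemma hmul1 : left_id hone hmul.
Proof.
move=> a; apply/funext => k; rewrite /hmul big_ord_recl big1 => [|i _].
  by rewrite /hone bin0 subn0 !mul1r addr0.
by rewrite /hone mulr0 mul0r.
Qed.

Lemma hone_neq0 : hone != 0.
Proof.
by apply/eqP => /(congr1 (fun a => a 0%N)) /eqP; rewrite /hone oner_eq0.
Qed.

HB.instance Definition _ := GRing.Zmodule_isComNzRing.Build (hurwitz R)
  hmulA hmulC hmul1 hmulDl hone_neq0.

Lemma hcoefD a b k : (a + b) k = a k + b k. Proof. by []. Qed.
Lemma hcoefN a k : (- a) k = - a k. Proof. by []. Qed.
Lemma hcoefM a b k :
  (a * b) k = \sum_(i < k.+1) ('C(k, i))%:R * a i * b (k - i)%N.
Proof. by []. Qed.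
Lemma hcoefM0 a b : (a * b) 0%N = a 0%N * b 0%N.
Proof. exact: hmul_coef0. Qed.

End HurwitzRing.

(** * Differential equations for arcsinh and its exponential *)

Section HurwitzODE.
Variable R : comNzRingType.
Implicit Types (a b c : hurwitz R) (q : R).

Lemma hderivB a b : hderiv (a - b) = hderiv a - hderiv b. Proof. by []. Qed.

Definition hconst q : hurwitz R := fun k => q *+ (k == 0%N).
Definition hX : hurwitz R := fun k => (k == 1%N)%:R.

Lemma hderiv_mul a b : hderiv (a * b) = hderiv a * b + a * hderiv b.
Proof. exact: hderivM. Qed.

Lemma hderiv_const q : hderiv (hconst q) = 0.
Proof. by apply/funext. Qed.

Lemma hderiv1 : hderiv (1 : hurwitz R) = 0.
Proof. by apply/funext. Qed.

Lemma hderivX : hderiv hX = 1.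
Proof. by apply/funext. Qed.

Lemma hmulconst q a k : (hconst q * a) k = q * a k.
Proof.
rewrite hcoefM big_ord_recl big1 => [|i _].
  by rewrite /hconst /= bin0 mulr1n mul1r subn0 addr0.
by rewrite /hconst /= mulr0n mulr0 mul0r.
Qed.

Lemma hmulX a k : (hX * a) k = k%:R * a k.-1.
Proof.
rewrite hcoefM; case: k => [|k]; first by rewrite big_ord1 /hX mulr0 !mul0r.
rewrite 2!big_ord_recl big1 => [|i _]; last by rewrite /hX mulr0 mul0r.
by rewrite /hX /= mulr0 mul0r add0r addr0 mulr1 bin1 subn1.
Qed.

(** Uniqueness for a first-order linear equation: coefficient k+1 of b depends linearly on the
    coefficients of b up to k. *)
Lemma hderiv_eq_mul0 a b : hderiv b = a * b -> b 0%N = 0 -> b = 0.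
Proof.
move=> Db b0; apply/funext => k; elim/ltn_ind: k => -[//|k] IHk.
rewrite -[LHS]/(hderiv b k) Db mulrC hcoefM big1 // => i _.
by rewrite IHk ?mulr0 ?mul0r.
Qed.

Lemma hderiv_eq0 a : hderiv a = 0 -> a 0%N = 0 -> a = 0.
Proof. by move=> Da; apply: (hderiv_eq_mul0 (a := 0)); rewrite Da mul0r. Qed.

(* The derivative of [arcsinh (sqrt q * x) / sqrt q]. *)
Fixpoint arcsinh' q (k : nat) : R :=
  match k with
  | 0 => 1
  | 1 => 0
  | k'.+2 => - (q * k'.+1%:R ^+ 2) * arcsinh' q k'
  end.

(* The exponential of [arcsinh (sqrt q * x) / sqrt q]. *)
Fixpoint exp_arcsinh q (k : nat) : R :=
  match k with
  | 0 => 1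
  | 1 => 1
  | k'.+2 => (1 - q * k'%:R ^+ 2) * exp_arcsinh q k'
  end.

Definition quad q : hurwitz R := 1 + hconst q * (hX * hX).

Lemma quad_arcsinh' q :
  quad q * hderiv (arcsinh' q) + hconst q * (hX * (arcsinh' q : hurwitz R)) = 0.
Proof.
apply/funext => k; rewrite /quad mulrDl mul1r !hcoefD -!mulrA !hmulconst !hmulX.
rewrite -[RHS]/(0 : R).
by case: k => [|[|k]]; rewrite /hderiv /=; ring.
Qed.

(** Identifies [arcsinh' q] with 1 / sqrt (1 + q x^2): the derivative of the left side is a multiple
    of the expression in [quad_arcsinh']. *)
Lemma arcsinh'_sqr q :
  (arcsinh' q : hurwitz R) * (arcsinh' q : hurwitz R) * quad q = 1.
Proof.
set g : hurwitz R := arcsinh' q.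
apply/eqP; rewrite -subr_eq0; apply/eqP/hderiv_eq0; last first.
  rewrite hcoefD hcoefN !hcoefM0 /quad hcoefD hmulconst hmulX.
  by rewrite -[(1 : hurwitz R) 0%N]/(1 : R) -[g 0%N]/(1 : R); ring.
have Dquad : hderiv (quad q) = hconst q * (hX + hX).
  rewrite /quad -[LHS]/(hderiv 1 + hderiv (hconst q * (hX * hX))).
  by rewrite hderiv1 !hderiv_mul hderiv_const hderivX; ring.
rewrite hderivB !hderiv_mul Dquad hderiv1.
transitivity ((g + g) * (quad q * hderiv g + hconst q * (hX * g))); first by ring.
by rewrite quad_arcsinh' mulr0.
Qed.

(* [F = exp (c * arcsinh (sqrt q * x) / sqrt q)] is characterised either by  *)
(* this second-order equation or by its logarithmic derivative.              *)
Lemma exp_arcsinh_ODE q (c F : hurwitz R) :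
    quad q * hderiv (hderiv F) + hconst q * (hX * hderiv F) = F ->
    hderiv c = 0 -> c * c = 1 -> F 1%N = c 0%N * F 0%N ->
  hderiv F = c * (arcsinh' q : hurwitz R) * F.
Proof.
set g : hurwitz R := arcsinh' q => EF Dc cc F1.
have Eg := quad_arcsinh' q; have gg := arcsinh'_sqr q; rewrite -/g in Eg gg.
apply/eqP; rewrite -subr_eq0; apply/eqP.
(* The defect h starts at 0 and satisfies a homogeneous first-order equation. *)
set h := _ - _.
apply: (@hderiv_eq_mul0 (- g * g * (hconst q * hX + c * quad q * g))); last first.
  rewrite /h hcoefD hcoefN !hcoefM0 -[hderiv F 0%N]/(F 1%N) F1.
  by rewrite -[g 0%N]/(1 : R); ring.
have Dh : hderiv h = hderiv (hderiv F) - c * (hderiv g * F + g * hderiv F).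
  by rewrite /h hderivB !hderiv_mul Dc; ring.
have EQ : quad q * hderiv h = - (hconst q * hX + c * quad q * g) * h.
  rewrite Dh /h.
  transitivity ((quad q * hderiv (hderiv F) + hconst q * (hX * hderiv F))
    - c * F * (quad q * hderiv g + hconst q * (hX * g))
    - hconst q * hX * hderiv F + c * hconst q * hX * g * F
    - c * g * quad q * hderiv F); first by ring.
  rewrite EF Eg mulr0 subr0 -[X in X - _ + _ - _]mul1r -cc -[X in X * F]mulr1 -gg.
  by ring.
by rewrite -[LHS]mul1r -gg -mulrA EQ; ring.
Qed.

End HurwitzODE.
Arguments hX {R}.

Lemma exp_arcsinh_coef_ODE (R : comNzRingType) (q : R) (F : hurwitz R) :
    (forall k, F k.+2 = (1 - q * k%:R ^+ 2) * F k) ->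
  quad q * hderiv (hderiv F) + hconst q * (hX * hderiv F) = F.
Proof.
move=> F2; apply/funext => k.
rewrite /quad mulrDl mul1r !hcoefD -!mulrA !hmulconst !hmulX.
by case: k => [|[|k]]; rewrite /hderiv /= !F2; ring.
Qed.

(** F' = g F read on coefficients: the recursion that [partition_sum_card] asks for. *)
Lemma exp_arcsinhS (R : comNzRingType) (q : R) k :
  exp_arcsinh q k.+1 =
    \sum_(i < k.+1) ('C(k, i))%:R * arcsinh' q i * exp_arcsinh q (k - i)%N.
Proof.
have /(congr1 (fun F : hurwitz R => F k)) :=
  exp_arcsinh_ODE (exp_arcsinh_coef_ODE (fun=> erefl))
    (@hderiv1 R) (mul1r 1) (esym (mul1r (exp_arcsinh q 0))).
by rewrite mul1r.
Qed.

Definition cosh_arcsinh q : hurwitz rat :=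
  fun k => if odd k then 0 else exp_arcsinh q k.
Definition sinh_arcsinh q : hurwitz rat :=
  fun k => if odd k then exp_arcsinh q k else 0.

(** With u = arcsinh (2 x) / 2 this is sinh u cosh u = sinh (2 u) / 2 = x. The product obeys y_(k+2)
    = 4 (1 - k^2) y_k, and the factor vanishes at k = 1. *)
Lemma sinh_mul_cosh_arcsinh4 :
  (sinh_arcsinh 4 * cosh_arcsinh 4 : hurwitz rat) = hX.
Proof.
set s := sinh_arcsinh 4; set c := cosh_arcsinh 4.
set g : hurwitz rat := arcsinh' 4.
have half (a b : hurwitz rat) : a + a = b + b -> a = b.
  move=> ab; apply/funext => k.
  by have := congr1 (fun F : hurwitz rat => F k) ab; rewrite !hcoefD; lra.
(* The signs e = 1 and e = -1 give exp u and exp (- u); their sum and difference separate into s' =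
   g c and c' = g s. *)
have ODE (e : rat) : e * e = 1 -> hderiv (c + hconst e * s) =
    hconst e * g * (c + hconst e * s).
  move=> ee; apply: exp_arcsinh_ODE.
  - apply: exp_arcsinh_coef_ODE => k; rewrite !hcoefD !hmulconst /c /s.
    by rewrite /cosh_arcsinh /sinh_arcsinh /= negbK; case: (odd k) => /=; ring.
  - exact: hderiv_const.
  - by apply/funext => k; rewrite hmulconst /hconst mulrnAr ee.
  - by rewrite !hcoefD !hmulconst /c /s /cosh_arcsinh /sinh_arcsinh /hconst /=; ring.
have h1 : hconst (1 : rat) = 1 by apply/funext.
have hN1 : hconst (-1 : rat) = -1 by apply/funext => -[|k]; rewrite // hcoefN /hconst mulr0n oppr0.
have := ODE 1 (mulr1 _); have := ODE (-1) (mulrNN 1 1).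
rewrite h1 hN1 mul1r mulN1r mul1r hderivB -[hderiv (c + s)]/(hderiv c + hderiv s).
move=> EN EP.
have Ds : hderiv s = g * c.
  apply: half; transitivity ((hderiv c + hderiv s) - (hderiv c - hderiv s)).
    by ring.
  by rewrite EP EN; ring.
have Dc : hderiv c = g * s.
  apply: half; transitivity ((hderiv c + hderiv s) + (hderiv c - hderiv s)).
    by ring.
  by rewrite EP EN; ring.
have ggQ := arcsinh'_sqr (4 : rat); have Dg := quad_arcsinh' (4 : rat).
rewrite -/g in ggQ Dg.
set y := s * c; set z := s * s + c * c.
have Dy : hderiv y = g * z by rewrite /y /z hderiv_mul Ds Dc; ring.
have Dz : hderiv z = (1 + 1 + 1 + 1) * (g * y).
  by rewrite /y /z -[LHS]/(hderiv (s * s) + hderiv (c * c)) !hderiv_mul Ds Dc; ring.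
have Ey : quad 4 * hderiv (hderiv y) + hconst 4 * (hX * hderiv y) =
    (1 + 1 + 1 + 1) * y.
  transitivity (z * (quad 4 * hderiv g + hconst 4 * (hX * g)) +
      (1 + 1 + 1 + 1) * (g * g * quad 4) * y).
    by rewrite Dy hderiv_mul Dz; ring.
  by rewrite Dg ggQ; ring.
have yS k : y k.+2 = 4 * (1 - k%:R ^+ 2) * y k.
  have /(congr1 (fun F : hurwitz rat => F k)) := Ey.
  rewrite /quad !mulrDl !mul1r !hcoefD -!mulrA !hmulconst !hmulX.
  by case: k => [|[|k]]; rewrite /hderiv /=; lra.
have y0 : y 0%N = 0 by rewrite /y hcoefM0 mul0r.
have y1 : y 1%N = 1.
  rewrite -[LHS]/(hderiv y 0%N) Dy hcoefM0 /z hcoefD !hcoefM0.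
  by rewrite -[s 0%N]/(0 : rat) -[c 0%N]/(1 : rat) -[g 0%N]/(1 : rat); ring.
apply/funext => k; elim/ltn_ind: k => -[|[|k]] IHk //.
rewrite yS; case: k IHk => [|[|k]] IHk; first by rewrite y0 mulr0.
  by rewrite subrr mulr0 mul0r.
by rewrite IHk // mulr0.
Qed.

(* The exponential generating function of this sequence is                   *)
(* [1 / cosh (arcsinh (2 x) / 2) = sinh (arcsinh (2 x) / 2) / x].            *)
Definition sech_arcsinh k : rat :=
  if odd k then 0 else exp_arcsinh 4 k.+1 / k.+1%:R.

(** A positive even coefficient of exp u / cosh u = 1 + tanh u, where tanh u is odd. *)
Lemma sum_sech_exp_arcsinh n : ~~ odd n -> (0 < n)%N ->
  \sum_(i < n.+1) 'C(n, i)%:R * (sech_arcsinh i * exp_arcsinh 4 (n - i)) = 0.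
Proof.
move=> n_even n_gt0.
have := congr1 (fun F : hurwitz rat => F n.+1) sinh_mul_cosh_arcsinh4.
rewrite /hX eqSS -[n == 0%N]negbK -lt0n n_gt0 /=.
rewrite hcoefM big_ord_recl mulr0 mul0r add0r => sc0.
(* Multiplying by n+1 turns C(n, i) into (i+1) C(n+1, i+1), which absorbs the denominator of
   [sech_arcsinh]. *)
have n1_neq0 : n.+1%:R != 0 :> rat by rewrite pnatr_eq0.
apply: (mulfI n1_neq0); rewrite mulr0 -[RHS]sc0 mulr_sumr.
apply: eq_bigr => i _; rewrite lift0 subSS /sinh_arcsinh /cosh_arcsinh.
rewrite /sech_arcsinh [odd i.+1]/=; move: (exp_arcsinh _ i.+1) => e.
case: ifP => /= i_odd; first by rewrite !(mulr0, mul0r).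
rewrite oddB -1?ltnS // (negPf n_even) i_odd /=.
rewrite [LHS]mulrA -natrM mul_bin_diag natrM /=.
by field; rewrite addrC natr1 pnatr_eq0.
Qed.

(** The step of the recursion factors as 1 - 4 (2m+1)^2 = - (4m+1) (4m+3). *)
Lemma sech_arcsinhE m :
  sech_arcsinh (2 * m) =
    (-1) ^+ m * (4 * m)`!%:R / (2 ^+ (2 * m) * (2 * m).+1`!%:R).
Proof.
have sechE k : sech_arcsinh (2 * k) = exp_arcsinh 4 (2 * k).+1 / (2 * k).+1%:R.
  by rewrite /sech_arcsinh mul2n odd_double.
elim: m => [|m IHm].
  by rewrite sechE muln0 fact0 factS !expr0 !mul1r.
have -> : sech_arcsinh (2 * m.+1) = (1 - 4 * (2 * m).+1%:R ^+ 2) *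
    ((2 * m).+1%:R * sech_arcsinh (2 * m)) / (2 * m).+3%:R.
  by rewrite !sechE !mulnS /= [_%:R * (_ / _)]mulrC divfK // pnatr_eq0.
rewrite IHm !mulnS !addSn !add0n !factS !natrM !exprS.
have f_neq0 : (2 * m)`!%:R != 0 :> rat by rewrite pnatr_eq0 -lt0n fact_gt0.
have e_neq0 : 2 ^+ (2 * m) != 0 :> rat by rewrite expf_neq0.
move: (_ ^+ (2 * m)) (_ ^+ m) (2 * m)`!%:R ((4 * m)`!%:R) e_neq0 f_neq0 => e c f g.
move=> e_neq0 f_neq0.
rewrite -!natr1 !natrM; field.
by rewrite f_neq0 e_neq0 -natrM !natr1 !pnatr_eq0.
Qed.

(** * Sums over set partitions *)

Section PartitionSums.
Variables (T : finType) (R : comNzRingType).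
Implicit Types (A B C : {set T}) (P : {set {set T}}) (w : {set T} -> R).

Definition partition_sum w A : R :=
  \sum_(P | partition P A) \prod_(B in P) w B.

Lemma partition_sum0 w : partition_sum w set0 = 1.
Proof.
rewrite /partition_sum (big_pred1 set0) ?big_set0 // => P.
by rewrite partition_set0.
Qed.

(** The side condition of the reindexing in [partition_sum_peel], which removes the block of x. *)
Lemma partition_pblockU1 A B P x : x \in B ->
  (partition (B |: P) A && (pblock (B |: P) x == B)) && ((B |: P) :\ B == P) =
  (B \subset A) && partition P (A :\: B).
Proof.
move=> xB; apply/idP/idP.
  move=> /andP[/andP[parBP _] /eqP defP].
  have BnP : B \notin P by rewrite -defP !inE eqxx.
  have BA : B \subset A.
    by rewrite -(cover_partition parBP) (bigcup_max B) // setU11.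
  rewrite BA /=.
  have := partitionD1 parBP (setU11 B P); rewrite defP; exact.
case/andP => BA parP.
have B0 : B != set0 by apply/set0Pn; exists x.
have dis : [disjoint B & A :\: B].
  by rewrite -setI_eq0 setDE setICA setICr setI0.
have BnP : B \notin P.
  apply: contraTN dis => BP; rewrite -setI_eq0 -(cover_partition parP).
  apply/set0Pn; exists x; rewrite inE xB; apply/bigcupP.
  by exists B.
have parBP : partition (B |: P) A.
  by have := partitionU1 parP B0 dis; rewrite setDE setUIr setUCr setIT (setUidPr BA).
rewrite parBP (def_pblock (partition_trivIset parBP) (setU11 B P) xB) eqxx /=.
by rewrite setU1K.
Qed.

Lemma partition_sum_peel w A x : x \in A ->
  partition_sum w A =
    \sum_(B : {set T} | (x \in B) && (B \subset A)) w B * partition_sum w (A :\: B).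
Proof.
move=> xA; rewrite /partition_sum.
rewrite (partition_big (fun P => pblock P x) (fun B : {set T} => (x \in B) && (B \subset A))).
  apply: eq_bigr => B /andP[xB BA]; rewrite mulr_sumr.
  rewrite (reindex_onto (fun P => B |: P) (fun P => P :\ B)) /=; last first.
    move=> P /andP[parP /eqP defB]; rewrite setD1K // -defB pblock_mem //.
    by rewrite (cover_partition parP).
  apply: eq_big => [P|P]; first by rewrite partition_pblockU1 // BA.
  rewrite partition_pblockU1 // => /andP[_ parP].
  rewrite big_setU1 //=; apply/negP => BP.
  have : B \subset A :\: B by rewrite -(cover_partition parP) (bigcup_max B).
  by move/subsetP/(_ x xB); rewrite inE xB.
move=> P parP; have xP : x \in cover P by rewrite (cover_partition parP).
by rewrite mem_pblock xP -(cover_partition parP) (bigcup_max (pblock P x)) ?pblock_mem.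
Qed.

(** Peeling the block of an element of A leaves only blocks inside A, and the hypothesis on crossing
    blocks passes to A minus that block. *)
Lemma partition_sumU w A C :
    [disjoint A & C] ->
    (forall B, B \subset A :|: C -> ~~ (B \subset A) -> ~~ (B \subset C) ->
      w B = 0) ->
  partition_sum w (A :|: C) = partition_sum w A * partition_sum w C.
Proof.
elim: {A}_.+1 {-2}A (ltnSn #|A|) => // k IHk A; rewrite ltnS => leAk disAC w0.
have [->|[x xA]] := set_0Vmem A; first by rewrite set0U partition_sum0 mul1r.
rewrite (partition_sum_peel w (x := x)) ?inE ?xA //.
rewrite (partition_sum_peel w xA) mulr_suml.
rewrite (bigID (fun B : {set T} => B \subset A)) /= [X in _ + X]big1 ?addr0; last first.
  move=> B /andP[/andP[xB BAC] nBA]; rewrite w0 ?mul0r //.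
  by apply/negP => /subsetP/(_ x xB); apply/negP; rewrite (disjointFr disAC xA).
apply: eq_big => [B|B /andP[/andP[xB BAC] BA]].
  rewrite -andbA; case: (x \in B) => //=; case BA: (B \subset A); rewrite ?andbF //.
  by rewrite andbT (subset_trans BA) ?subsetUl.
have disBC : [disjoint B & C] by apply: disjointWl disAC.
have -> : (A :|: C) :\: B = (A :\: B) :|: C.
  rewrite setDUl; congr (_ :|: _); apply/setDidPl; by rewrite disjoint_sym.
rewrite IHk ?mulrA //.
- rewrite (leq_trans _ leAk) // proper_card //.
  by apply/properP; split; [exact: subsetDl|exists x; rewrite ?inE ?xB].
- by apply: disjointWl disAC; exact: subsetDl.
move=> B' sB' nA nC; have [/w0 w0B'|] := boolP (B' \subset A :|: C).
  have [B'A|/w0B'] := boolP (B' \subset A); last exact.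
  case/negP: nA; apply/subsetP => y yB'; have:= subsetP sB' y yB'.
  rewrite !inE => /orP[//|yC]; move: (subsetP B'A y yB') => yA.
  by rewrite (disjointFr disAC yA) in yC.
by rewrite (subset_trans sB') // setSU // subsetDl.
Qed.

Lemma sum_subsets_card (g : nat -> R) A :
  \sum_(B : {set T} | B \subset A) g #|B| = \sum_(k < #|A|.+1) 'C(#|A|, k)%:R * g k.
Proof.
rewrite (partition_big (fun B : {set T} => inord #|B| : 'I_#|A|.+1) predT) //=.
apply: eq_bigr => k _.
have <- : (\sum_(B in [set B : {set T} | B \subset A & #|B| == k]) 1)%N =
  'C(#|A|, k) by rewrite sum1_card cards_draws.
rewrite natr_sum mulr_suml.
apply: eq_big => [B|B /andP[BA /eqP defk]].
  rewrite inE; case BA: (B \subset A) => //=.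
  by rewrite -val_eqE /= inordK // ltnS subset_leq_card.
by rewrite mul1r -defk inordK // ltnS subset_leq_card.
Qed.

(** The exponential formula in the form F' = g F: the block of a chosen x has i further elements,
    whence the shifted weight [g #|B|.-1]. *)
Lemma partition_sum_card (g f : nat -> R) w A :
    f 0%N = 1 ->
    (forall k, f k.+1 = \sum_(i < k.+1) 'C(k, i)%:R * g i * f (k - i)%N) ->
    (forall B, B \subset A -> B != set0 -> w B = g #|B|.-1) ->
  partition_sum w A = f #|A|.
Proof.
move=> f0 fS; elim: {A}_.+1 {-2}A (ltnSn #|A|) => // k IHk A.
rewrite ltnS => leAk wg.
have [->|[x xA]] := set_0Vmem A; first by rewrite partition_sum0 cards0.
rewrite (partition_sum_peel w xA) (cardsD1 x A) xA add1n fS.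
have cardAx : #|A| = #|A :\ x|.+1 by rewrite (cardsD1 x A) xA.
under [RHS]eq_bigr => i _ do rewrite -mulrA.
rewrite -(sum_subsets_card (fun i => g i * f (#|A :\ x| - i)%N)).
rewrite (reindex_onto (fun B : {set T} => x |: B) (fun B : {set T} => B :\ x)) /=; last first.
  by move=> B /andP[xB _]; rewrite setD1K.
apply: eq_big => [B|B /andP[/andP[xB BA] /eqP defB]].
  rewrite setU11 subUset sub1set xA /= subsetD1; congr (_ && _).
  apply/eqP/idP => [<-|]; first by rewrite !inE eqxx.
  by move/setU1K.
have xnB : x \notin B by rewrite -defB !inE eqxx.
rewrite wg //; last by apply/set0Pn; exists x; rewrite setU11.
rewrite cardsU1 xnB add1n /=; congr (_ * _).
have -> : A :\: (x |: B) = (A :\ x) :\: B by rewrite setDDl.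
have BAx : B \subset A :\ x.
  by rewrite subsetD1 xnB (subset_trans _ BA) // subsetUr.
rewrite IHk; first by rewrite cardsD (setIidPr BAx).
  rewrite (leq_ltn_trans (subset_leq_card (subsetDl _ _))) //.
  by rewrite (leq_trans _ leAk) // cardAx.
move=> C /subset_trans CA; apply: wg; apply: CA.
by rewrite !(subset_trans (subsetDl _ _)) // subsetDl.
Qed.

End PartitionSums.

(** * Stabilizers of colorings and their Coxeter generators *)

Section SignedColorings.
Variable n : nat.
Implicit Types (u w : signed_perm n) (v : 'I_n -> int) (i j : 'I_n) (s : bool).

Lemma signed_mul1E u w i : (u * w)%g.1 i = u.1 i (+) w.1 (u.2 i).
Proof. by rewrite ffunE. Qed.

Lemma signed_mul2E u w i : (u * w)%g.2 i = w.2 (u.2 i).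
Proof. by rewrite permM. Qed.

Lemma signed_one1E i : (1%g : signed_perm n).1 i = false.
Proof. by rewrite ffunE. Qed.

Lemma signed_one2E i : (1%g : signed_perm n).2 i = i.
Proof. by rewrite perm1. Qed.

Lemma signed_permP u w :
  (forall i, u.1 i = w.1 i) -> (forall i, u.2 i = w.2 i) -> u = w.
Proof.
case: u w => [e p] [e' p'] /= He Hp.
by congr pair; [apply/ffunP|apply/permP].
Qed.

(** Integer counterpart of the right action of [signed_mx] on row vectors. *)
Definition signed_act v w : 'I_n -> int :=
  let p : 'S_n := (w.2^-1)%g in fun j => (-1) ^+ w.1 (p j) * v (p j).

Lemma signed_actE v w i : signed_act v w (w.2 i) = (-1) ^+ w.1 i * v i.
Proof. by rewrite /signed_act permK. Qed.

Lemma signed_act1 v : signed_act v 1%g = v.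
Proof.
apply/funext => i; rewrite -[X in signed_act _ _ X]signed_one2E signed_actE.
by rewrite signed_one1E mul1r.
Qed.

Lemma signed_actM v u w : signed_act v (u * w)%g = signed_act (signed_act v u) w.
Proof.
apply/funext => j; rewrite -[j](permKV (u * w)%g.2); move: (_ j) => i.
rewrite signed_actE signed_mul2E !signed_actE signed_mul1E signr_addb.
by rewrite mulrCA mulrA.
Qed.

Definition color_stab v : {set signed_perm n} :=
  [set w | `[< signed_act v w = v >]].

Lemma color_stabP v w :
  reflect (forall i, v i = (-1) ^+ w.1 i * v (w.2 i)) (w \in color_stab v).
Proof.
rewrite inE; apply: (iffP (asboolP _)) => [vw i|vw].
  by rewrite -[in RHS]vw signed_actE mulrA -expr2 sqrr_sign mul1r.
apply/funext => j; rewrite -[j](permKV w.2) signed_actE.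
by rewrite [in LHS]vw mulrA -expr2 sqrr_sign mul1r.
Qed.

Lemma color_stab_group_set v : group_set (color_stab v).
Proof.
apply/group_setP; split; first by rewrite inE signed_act1; apply/asboolP.
move=> u w; rewrite !inE => /asboolP vu /asboolP vw; apply/asboolP.
by rewrite signed_actM vu.
Qed.

Canonical color_stab_group v := Group (color_stab_group_set v).

Lemma color_stabJ v w : color_stab (signed_act v w) = (color_stab v :^ w)%g.
Proof.
apply/setP => x; rewrite mem_conjg !inE conjgE invgK.
apply/asbool_equiv_eq; rewrite !signed_actM; split => [->|E].
  by rewrite -signed_actM mulgV signed_act1.
by rewrite -[in RHS]E -[in RHS]signed_actM mulVg signed_act1.
Qed.

(** Attached to the relation x_i = (-1)^s x_j. Allowing i = j covers sign changes too, since x_i = -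
    x_i means x_i = 0. *)
Definition signed_refl i j s : signed_perm n :=
  ([ffun k => s && ((k == i) || (k == j))], tperm i j).

Lemma transpositionE i j : transposition i j = signed_refl i j false.
Proof. by []. Qed.

Lemma sign_changeE i : sign_change i = signed_refl i i true.
Proof.
apply: signed_permP => k; first by rewrite !ffunE orbb.
by rewrite /= tperm1.
Qed.

Lemma mem_signed_refl v i j s :
  (signed_refl i j s \in color_stab v) = (v i == (-1) ^+ s * v j).
Proof.
apply/color_stabP/eqP => [/(_ i)|vij k]; first by rewrite /= ffunE eqxx andbT tpermL.
rewrite /= ffunE; case: tpermP => [->|->|/eqP/negPf-> /eqP/negPf->].
- by rewrite eqxx andbT.
- by rewrite eqxx orbT andbT vij mulrA -expr2 sqrr_sign mul1r.
- by rewrite andbF mul1r.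
Qed.

(** Reflections suffice to compare stabilizers: by [color_stabP], membership of any w is a
    conjunction of relations, each being membership of one reflection. *)
Lemma color_stabS v v' :
  reflect (forall i j s, v i = (-1) ^+ s * v j -> v' i = (-1) ^+ s * v' j)
          (color_stab v \subset color_stab v').
Proof.
apply: (iffP subsetP) => [sub i j s /eqP|sub w /color_stabP vw].
  by rewrite -mem_signed_refl => /sub; rewrite mem_signed_refl => /eqP.
by apply/color_stabP => i; apply: sub.
Qed.

Definition ord_prev j : 'I_n := Ordinal (leq_ltn_trans (leq_pred j) (ltn_ord j)).

Definition simple_refl j : signed_perm n :=
  if j == 0%N :> nat then sign_change j else transposition (ord_prev j) j.

Lemma simple_reflectionsE : simple_reflections n = [set simple_refl j | j : 'I_n].
Proof.
apply/setP => w; rewrite inE; apply/idP/imsetP => [|[j _ ->]].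
  case/orP => /imsetP[].
    by move=> i; rewrite inE => i0 ->; exists i => //; rewrite /simple_refl i0.
  move=> [i j]; rewrite inE /= => /eqP ij ->; exists j => //.
  rewrite /simple_refl ij /=; congr transposition; apply/val_inj.
  by rewrite /= ij.
rewrite /simple_refl; case: ifP => j0; apply/orP; [left|right].
  by apply: imset_f; rewrite inE.
apply: (imset_f (fun p => transposition p.1 p.2) (x := (ord_prev j, j))).
by rewrite inE /= prednK // lt0n j0.
Qed.

Lemma simple_refl_inj : injective simple_refl.
Proof.
move=> i j; rewrite /simple_refl; case: ifP => i0; case: ifP => j0.
- by move=> _; apply/val_inj; rewrite /= (eqP i0) (eqP j0).
- by move/(congr1 (fun w => w.1 i)); rewrite !ffunE eqxx.
- by move/(congr1 (fun w => w.1 j)); rewrite !ffunE eqxx.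
move=> /(congr1 snd) /= E.
have lt_prev (k : 'I_n) : k != 0%N :> nat -> (ord_prev k < k)%N.
  by move=> k0; rewrite /= prednK // lt0n.
(* The only point lowered by the transposition of k-1 and k is k, so the permutation determines
   k. *)
have gtE k l m : tperm (ord_prev k) k l = m -> k != 0%N :> nat -> (m < l)%N -> l = k.
  move=> <- k0; case: tpermP => [->|->//|]; last by rewrite ltnn.
  by rewrite ltnNge ltnW // lt_prev.
apply/esym/(gtE i j (ord_prev j)); rewrite ?i0 ?lt_prev ?j0 //.
by rewrite E tpermR.
Qed.

End SignedColorings.
Arguments simple_refl {n} j.

(** * Generation of standard parabolic subgroups *)

Section StandardParabolic.
Variable n : nat.
Implicit Types (p : 'S_n) (i j : 'I_n).

Definition unsigned_perm p : signed_perm n := ([ffun=> false], p).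

Lemma unsigned_permM : {morph unsigned_perm : p q / (p * q)%g}.
Proof.
move=> p q; apply: signed_permP => i; last by rewrite signed_mul2E.
by rewrite signed_mul1E !ffunE.
Qed.

Lemma natz_signE (a b : nat) (s : bool) :
  (a%:Z == (-1) ^+ s * b%:Z) = (a == b) && (s ==> (a == 0%N)).
Proof. by case: s => /=; rewrite ?expr1 ?expr0; apply/eqP/andP; lia. Qed.

Variable c : 'I_n -> nat.
Hypothesis c_mono : {homo c : i j / (i <= j)%N}.

Definition std_coloring i : int := (c i)%:Z.

Definition std_index : {set 'I_n} :=
  [set j : 'I_n | if j == 0%N :> nat then c j == 0%N else c (ord_prev j) == c j].

Lemma mem_simple_refl j :
  (simple_refl j \in color_stab std_coloring) = (j \in std_index).
Proof.
rewrite [RHS]inE /simple_refl; case: ifP => _.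
  by rewrite sign_changeE mem_signed_refl natz_signE eqxx.
by rewrite transpositionE mem_signed_refl natz_signE andbT.
Qed.

Let G := <<(simple_refl @: std_index)%SET>>%G.

(** By monotonicity b-1 has the same color; conjugating the transposition of a and b-1 by the simple
    reflection at b moves b-1 to b. *)
Lemma transposition_std (a b : 'I_n) : (a < b)%N -> c a = c b -> transposition a b \in G.
Proof.
case: b => b ltbn; elim: b ltbn => [//|b IHb] ltbn ltab cab.
pose b1 := Ordinal ltbn; pose b0 := Ordinal (ltnW ltbn).
have prevb : ord_prev b1 = b0 by apply/val_inj.
have cb0 : c b0 = c b1.
  by apply/eqP; rewrite eqn_leq c_mono /= ?leqnSn // -cab c_mono.
have Gb : transposition b0 b1 \in G.
  have -> : transposition b0 b1 = simple_refl b1 by rewrite /simple_refl /= prevb.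
  by apply/mem_gen/imset_f; rewrite inE /= prevb cb0.
move: ltab; rewrite ltnS leq_eqVlt => /predU1P[ab|ltab].
  by have -> : a = b0 by apply/val_inj.
have Ga : transposition a b0 \in G by apply: IHb; rewrite // cab.
have -> : transposition a b1 =
    (transposition b0 b1 * transposition a b0 * transposition b0 b1)%g.
  rewrite -!unsigned_permM; congr (_, _).
  rewrite -{1}[tperm b0 b1]tpermV -mulgA -conjgE tpermJ tpermL tpermD //.
    by rewrite -val_eqE /= gtn_eqF.
  by rewrite -val_eqE /= gtn_eqF // ltnW.
by rewrite !groupM.
Qed.

(** Position 0 also has color 0, and its sign change is conjugate to that at a under a transposition
    of the group. *)
Lemma sign_change_std (a : 'I_n) : c a = 0%N -> sign_change a \in G.
Proof.
move=> ca; have n_gt0 : (0 < n)%N by apply: leq_ltn_trans (ltn_ord a).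
pose a0 := Ordinal n_gt0.
have ca0 : c a0 = 0%N by apply/eqP; rewrite -leqn0 -ca c_mono.
have Ga0 : sign_change a0 \in G.
  have -> : sign_change a0 = simple_refl a0 by [].
  by apply/mem_gen/imset_f; rewrite inE /= ca0.
have [->//|a_gt0] := eqVneq a a0.
have -> : sign_change a =
    (transposition a0 a * sign_change a0 * transposition a0 a)%g.
  apply: signed_permP => i.
    rewrite !signed_mul1E !signed_mul2E !ffunE /= addbF.
    by case: tpermP => [->|->|/eqP/negPf-> /eqP/negPf->] //; rewrite eqxx.
  by rewrite !signed_mul2E /= !perm1 tpermK.
have Ga : transposition a0 a \in G.
  by apply: transposition_std; rewrite ?ca // lt0n.
by rewrite !groupM.
Qed.

(** Induction on the number of moved points: composing p with the transposition of i and p i makes i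
    fixed. *)
Lemma unsigned_perm_std p : (forall i, c (p i) = c i) -> unsigned_perm p \in G.
Proof.
have [k] := ubnP #|[set i | p i != i]|; elim: k p => // k IHk p lek cp.
have [p1|[i]] := set_0Vmem [set i | p i != i].
  have -> : p = 1%g.
    apply/permP => i; rewrite perm1; apply/eqP.
    by have := in_set0 i; rewrite -p1 inE => /negbFE.
  exact: group1.
rewrite inE => pi.
have -> : p = (p * tperm i (p i) * tperm i (p i))%g.
  by rewrite -mulgA tperm2 mulg1.
rewrite unsigned_permM groupM //; last first.
  rewrite -[unsigned_perm _]/(transposition i (p i)).
  have [ltip|ltpi|/val_inj ip] := ltngtP i (p i).
  - exact: transposition_std.
  - by rewrite /transposition tpermC transposition_std.
  - by rewrite -ip eqxx in pi.
apply: IHk => [|j]; last first.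
  rewrite permM; case: tpermP => [pj|pj|_ _]; last by [].
    by rewrite cp -[RHS]cp pj.
  by rewrite -cp -pj cp.
rewrite -ltnS (leq_trans _ lek) // ltnS proper_card //; apply/properP; split.
  apply/subsetP => j; rewrite !inE permM; apply: contra => /eqP pj.
  rewrite pj tpermD //; first by apply: contraNneq pi => ->; rewrite pj.
  by apply: contraNneq pi => pij; rewrite [p i]pij -(inj_eq (@perm_inj _ p)) pj pij.
by exists i; rewrite ?inE // permM tpermR eqxx.
Qed.

Lemma signs_std (e : {ffun 'I_n -> bool}) :
  (forall i, e i -> c i = 0%N) -> ((e, 1%g) : signed_perm n) \in G.
Proof.
have [k] := ubnP #|[set i | e i]|; elim: k e => // k IHk e lek ec.
have [e0|[i]] := set_0Vmem [set i | e i].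
  have -> : ((e, 1%g) : signed_perm n) = 1%g.
    apply: signed_permP => // i; rewrite ffunE /=.
    by have := in_set0 i; rewrite -e0 inE.
  exact: group1.
rewrite inE => ei; pose e' : {ffun 'I_n -> bool} := [ffun j => e j && (j != i)].
have -> : ((e, 1%g) : signed_perm n) = (((e', 1%g) : signed_perm n) * sign_change i)%g.
  apply: signed_permP => j; last by rewrite signed_mul2E !perm1.
  rewrite signed_mul1E !ffunE /= perm1.
  by have [->|] := eqVneq j i; rewrite ?ei ?andbT ?addbF.
rewrite groupM ?sign_change_std ?ec //; apply: IHk => [|j]; last first.
  by rewrite ffunE => /andP[/ec].
rewrite -ltnS (leq_trans _ lek) // ltnS proper_card //; apply/properP; split.
  by apply/subsetP => j; rewrite !inE ffunE => /andP[].
by exists i; rewrite ?inE // ffunE eqxx andbF.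
Qed.

Lemma gen_std : <<(simple_refl @: std_index)%SET>>%g = color_stab std_coloring.
Proof.
apply/eqP; rewrite eqEsubset gen_subG; apply/andP; split.
  by apply/subsetP => _ /imsetP[j jJ ->]; rewrite mem_simple_refl.
apply/subsetP => w /color_stabP cw.
have {cw} cw i : (c i == c (w.2 i)) && (w.1 i ==> (c i == 0%N)).
  by rewrite -natz_signE; apply/eqP/cw.
have -> : w = (((w.1, 1%g) : signed_perm n) * unsigned_perm w.2)%g.
  apply: signed_permP => i; first by rewrite signed_mul1E ffunE addbF.
  by rewrite signed_mul2E /= perm1.
rewrite groupM //.
  apply: signs_std => i wi; apply/eqP.
  by have /andP[_] := cw i; rewrite wi.
by apply: unsigned_perm_std => i; have /andP[/eqP->] := cw i.
Qed.

End StandardParabolic.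

(** * Blocks of a coloring and conjugation to sorted colorings *)

Section ColorBlocks.
Variable n : nat.
Implicit Types (v : 'I_n -> int) (w : signed_perm n) (i j : 'I_n).

Definition color_block v i : {set 'I_n} := [set j | `|v j|%N == `|v i|%N].

Definition color_blocks v : {set {set 'I_n}} :=
  [set color_block v i | i in [set i | v i != 0]].

Lemma color_block_refl v i : i \in color_block v i.
Proof. by rewrite inE. Qed.

Lemma eq_abszE (a b : int) :
  (`|a|%N == `|b|%N) = [exists s : bool, a == (-1) ^+ s * b].
Proof.
apply/eqP/existsP => [ab|[[] /eqP->]]; rewrite ?expr1 ?expr0; try lia.
have [->|nab] := eqVneq a b; first by exists false; rewrite mul1r.
by exists true; rewrite expr1 mulN1r; lia.
Qed.

Lemma color_stab_eqP v v' :
  color_stab v = color_stab v' <->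
  forall i j (s : bool), (v i == (-1) ^+ s * v j) = (v' i == (-1) ^+ s * v' j).
Proof.
split=> [E i j s|E]; first by rewrite -!mem_signed_refl E.
by apply/eqP; rewrite eqEsubset; apply/andP; split; apply/color_stabS => i j s;
  move=> /eqP H; apply/eqP; rewrite ?E // -E.
Qed.

Lemma color_stab_eq0 v v' : color_stab v = color_stab v' ->
  forall i, (v i == 0) = (v' i == 0).
Proof.
move=> /color_stab_eqP E i.
have eq0E (u : 'I_n -> int) : (u i == 0) = (u i == (-1) ^+ true * u i).
  by rewrite expr1 mulN1r; apply/eqP/eqP; lia.
by rewrite !eq0E E.
Qed.

Lemma color_stab_eq_block v v' : color_stab v = color_stab v' ->
  color_block v =1 color_block v'.
Proof.
move=> /color_stab_eqP E i; apply/setP => j; rewrite !inE !eq_abszE.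
by apply: eq_existsb => s.
Qed.

Lemma color_stab_eq_blocks v v' : color_stab v = color_stab v' ->
  color_blocks v = color_blocks v'.
Proof.
move=> E; rewrite /color_blocks (eq_imset _ (color_stab_eq_block E)).
suff -> : [set i | v i != 0] = [set i | v' i != 0] by [].
by apply/setP => i; rewrite !inE (color_stab_eq0 E).
Qed.

Lemma signed_act_abs v w i : `|signed_act v w (w.2 i)|%N = `|v i|%N.
Proof. by rewrite signed_actE abszMsign. Qed.

Lemma signed_act_block v w i :
  color_block (signed_act v w) (w.2 i) = w.2 @: color_block v i.
Proof.
apply/setP => j; rewrite -[j](permKV w.2) mem_imset ?inE ?signed_act_abs //.
exact: perm_inj.
Qed.

Lemma signed_act_eq0 v w i : (signed_act v w (w.2 i) == 0) = (v i == 0).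
Proof. by rewrite -!absz_eq0 signed_act_abs. Qed.

Lemma card_signed_act_block v w i :
  #|color_block (signed_act v w) (w.2 i)| = #|color_block v i|.
Proof. by rewrite signed_act_block card_imset //; apply: perm_inj. Qed.

Lemma card_signed_act_blocks v w :
  #|color_blocks (signed_act v w)| = #|color_blocks v|.
Proof.
suff -> : color_blocks (signed_act v w) =
    (fun B : {set 'I_n} => w.2 @: B) @: color_blocks v.
  by rewrite card_imset //; apply: imset_inj; apply: perm_inj.
rewrite /color_blocks -imset_comp; apply/setP => B; apply/imsetP/imsetP => -[i].
  rewrite inE -[i](permKV w.2) signed_act_eq0 => vi ->.
  by exists ((w.2^-1)%g i); rewrite ?inE // signed_act_block.
rewrite inE => vi ->; exists (w.2 i); rewrite ?inE ?signed_act_eq0 //.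
by rewrite signed_act_block.
Qed.

(** Sorting the absolute values conjugates every stabilizer to a standard one; w records the sorting
    permutation and the signs lost. *)
Lemma color_sort v : exists (c : 'I_n -> nat) (w : signed_perm n),
  {homo c : i j / (i <= j)%N} /\ v = signed_act (std_coloring c) w.
Proof.
pose t := [tuple `|v i|%N | i < n].
have /tuple_permP[p] : perm_eq (sort leq t) t by rewrite perm_sort.
set s := sort leq t => sp.
have size_s : size s = n by rewrite size_sort size_tuple.
have s_nth (i : 'I_n) : nth 0%N s i = `|v (p i)|%N.
  by rewrite sp -tnth_nth !tnth_mktuple.
exists (fun i => `|v (p i)|%N), (([ffun i => v (p i) < 0], p) : signed_perm n).
split=> [i j ij|].
  rewrite -!s_nth; apply: sorted_leq_nth; rewrite ?inE ?size_s //.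
  - exact: leq_trans.
  - by apply: sort_sorted; apply: leq_total.
apply/funext => j; rewrite -[j](permKV p); move: (_ j) => i.
set w : signed_perm n := (_, p); rewrite -[p i]/(w.2 i) signed_actE ffunE /=.
by rewrite /std_coloring abszE -intEsign.
Qed.

End ColorBlocks.

(** * Counting simple reflections block by block *)

Section StandardRank.
Variables (n : nat) (c : 'I_n -> nat).
Hypothesis c_mono : {homo c : i j / (i <= j)%N}.
Implicit Types i j : 'I_n.

Let v := std_coloring c.
Let J := std_index c.

Lemma std_block i j : (j \in color_block v i) = (c j == c i).
Proof. by rewrite inE. Qed.

Lemma lt_std_index i j : j \notin J -> (i < j)%N -> (c i < c j)%N.
Proof.
rewrite inE; have [/eqP->//|j0] := boolP (j == 0%N :> nat).
move=> neq ij; apply: leq_ltn_trans (_ : c (ord_prev j) < c j)%N.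
  by apply: c_mono; rewrite /= -ltnS prednK // lt0n.
by rewrite ltn_neqAle neq c_mono // leq_pred.
Qed.

Lemma std_index_neq0 j : j \notin J -> c j != 0%N.
Proof.
move=> jJ; have [j0|] := boolP (j == 0%N :> nat); first by move: jJ; rewrite inE j0.
rewrite -lt0n => j0; have n0 := ltn_trans j0 (ltn_ord j).
by rewrite -lt0n (leq_ltn_trans _ (lt_std_index (i := Ordinal n0) jJ j0)).
Qed.

Lemma std_index_inj : {in [predC J] &, injective c}.
Proof.
move=> i j iJ jJ cij; apply/val_inj/eqP; case: (ltngtP i j) => //.
  by move/(lt_std_index jJ); rewrite cij ltnn.
by move/(lt_std_index iJ); rewrite cij ltnn.
Qed.

Lemma std_first i : c i != 0%N -> exists2 j, j \notin J & c j = c i.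
Proof.
move=> ci; case: (arg_minnP (P := fun j => c j == c i) (fun j : 'I_n => j : nat) (eqxx _)).
move=> j /eqP cj minj; exists j => //; rewrite inE; case: ifP => j0; rewrite cj //.
apply/negP => /minj /=; rewrite leqNgt prednK ?lt0n ?j0 //.
by rewrite leqnn.
Qed.

(** The positions outside J are exactly the first positions of the nonzero blocks. *)
Lemma card_std_index : (#|J| + #|color_blocks v|)%N = n.
Proof.
rewrite -[RHS]card_ord -(cardsC J); congr (_ + _)%N.
have -> : color_blocks v = color_block v @: ~: J.
  apply/setP => B; apply/imsetP/imsetP => -[i].
    rewrite inE => /std_first[j jJ cj] ->; exists j; first by rewrite inE.
    by apply/setP => k; rewrite !std_block cj.
  by rewrite inE => /std_index_neq0 ci ->; exists i; rewrite // inE.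
rewrite card_in_imset // => i j; rewrite !in_setC => iJ jJ Eij.
apply: std_index_inj; [exact: iJ|exact: jJ|].
by apply/eqP; rewrite -std_block -Eij color_block_refl.
Qed.

Lemma odd_std_block i :
  odd #|color_block v i| = odd #|color_block v i :&: J| (+) (v i != 0).
Proof.
rewrite -(cardsID J) oddD; congr (_ (+) _).
have [vi|] := altP (v i =P 0).
  suff -> : color_block v i :\: J = set0 by rewrite cards0.
  apply/setP => j; rewrite in_setD std_block in_set0; apply/negP => /andP[jJ].
  have := std_index_neq0 jJ; move: vi; rewrite /v /std_coloring; lia.
move=> /std_first[j jJ cj]; suff -> : color_block v i :\: J = [set j] by rewrite cards1.
apply/setP => k; rewrite in_setD std_block in_set1; apply/andP/eqP => [[kJ /eqP ck]|->].
  by apply: std_index_inj; [exact: kJ|exact: jJ|rewrite ck cj].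
by rewrite jJ cj.
Qed.

End StandardRank.

(** * Orders of products of simple reflections *)

Section SimpleReflectionOrders.
Variable n : nat.
Implicit Types (u w : signed_perm n) (i j : 'I_n).

Definition signed_fix w i := ~~ w.1 i && (w.2 i == i).

Lemma signed_fix_commute u w :
  (forall i, signed_fix u i || signed_fix w i) -> commute u w.
Proof.
have stable u' w' i : (forall i, signed_fix u' i || signed_fix w' i) ->
    signed_fix u' i -> signed_fix u' (w'.2 i).
  move=> fix_uw ui; have /orP[//|/andP[_ /eqP/perm_inj E]] := fix_uw (w'.2 i).
  by rewrite E.
move=> fix_uw; have fix_wu i : signed_fix w i || signed_fix u i by rewrite orbC.
apply: signed_permP => i; rewrite ?signed_mul1E ?signed_mul2E.
  have /orP[fi|fi] := fix_uw i.
    have /andP[/negPf-> _] := stable _ _ _ fix_uw fi.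
    by have /andP[/negPf-> /eqP->] := fi; rewrite addbF.
  have /andP[/negPf-> _] := stable _ _ _ fix_wu fi.
  by have /andP[/negPf-> /eqP->] := fi; rewrite addbF.
have /orP[fi|fi] := fix_uw i.
  have /andP[_ /eqP->] := stable _ _ _ fix_uw fi.
  by have /andP[_ /eqP->] := fi.
have /andP[_ /eqP->] := stable _ _ _ fix_wu fi.
by have /andP[_ /eqP->] := fi.
Qed.

Lemma simple_refl_sqr j : (simple_refl j * simple_refl j = 1)%g.
Proof.
rewrite /simple_refl; case: ifP => _; apply: signed_permP => i.
- by rewrite signed_mul1E !ffunE perm1 addbb.
- by rewrite signed_mul2E !perm1.
- by rewrite signed_mul1E !ffunE.
- by rewrite signed_mul2E /= tpermK perm1.
Qed.

Lemma simple_refl_fix j i : i != j -> i != ord_prev j -> signed_fix (simple_refl j) i.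
Proof.
rewrite /simple_refl /signed_fix; case: ifP => _ ij ip; rewrite ffunE.
  by rewrite perm1 eqxx andbT.
by rewrite tpermD ?eqxx // eq_sym.
Qed.

Lemma adjacent_simple_refl_order i j : j = i.+1 :> nat ->
  (2 < #[simple_refl i * simple_refl j]%g)%N.
Proof.
move=> ji; set x := (_ * _)%g.
suff x2 : (x ^+ 2 != 1)%g.
  rewrite ltnNge; apply: contra x2 => x_le2; rewrite -order_dvdn.
  by have := order_gt0 x; case: #[x]%g x_le2 => [|[|[|]]].
have prevj : ord_prev j = i by apply/val_inj; rewrite /= ji.
have j0 : (j == 0%N :> nat) = false by rewrite ji.
rewrite expgS expg1; case: (posnP i) => [i0|i_gt0].
  (* When i = 0, the square of the product changes the sign of coordinate 0. *)
  apply/eqP => /(congr1 (fun w : signed_perm n => w.1 i)).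
  have i_neq_j : i != j by rewrite -val_eqE /= ji ltn_eqF.
  rewrite /x /simple_refl i0 eqxx j0 prevj.
  rewrite !(signed_mul1E, signed_mul2E) !ffunE /= !perm1.
  by rewrite tpermL eqxx eq_sym (negPf i_neq_j).
(* Otherwise the product is a 3-cycle, whose square sends i-1 to i. *)
apply/eqP => /(congr1 (fun w : signed_perm n => w.2 (ord_prev i))).
have i0 : (i == 0%N :> nat) = false by rewrite -leqn0 leqNgt i_gt0.
rewrite /x /simple_refl i0 j0 prevj !signed_mul2E /= perm1 tpermL tpermL.
have pj : ord_prev i != j by rewrite -val_eqE /= ji; lia.
have ij : i != j by rewrite -val_eqE /= ji; lia.
rewrite (tpermD pj ij) tpermR => /(congr1 val) /=; lia.
Qed.

End SimpleReflectionOrders.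

(** * Connected components of the Coxeter graph *)

Section StandardComponents.
Variables (n : nat) (c : 'I_n -> nat) (w : signed_perm n).
Hypothesis c_mono : {homo c : i j / (i <= j)%N}.
Implicit Types i j : 'I_n.

Let v := std_coloring c.
Let J := std_index c.
Let g j := (simple_refl j ^ w)%g.
Let S := ((simple_refl @: J)%SET :^ w)%g.

Lemma std_gensE : S = g @: J.
Proof.
rewrite /S; apply/setP => x; rewrite mem_conjg; apply/imsetP/imsetP => -[j jJ E].
  by exists j; rewrite // /g -E conjgKV.
by exists j; rewrite // E conjgK.
Qed.

Lemma std_gens_inj : injective g.
Proof. by move=> i j /conjg_inj/simple_refl_inj. Qed.

Lemma card_std_gens : (#|S| + #|color_blocks v|)%N = n.
Proof. by rewrite std_gensE card_imset ?card_std_index //; apply: std_gens_inj. Qed.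

(** A positive position of J has the color of its predecessor, so positions of J with different
    colors are at distance at least 2 and their reflections have disjoint supports. *)
Lemma std_gens_edge_color i j : i \in J -> j \in J ->
  coxeter_edge S (g i) (g j) -> c i = c j.
Proof.
move=> iJ jJ /and3P[_ _]; rewrite -conjMg orderJ; apply: contraTeq => cij.
have gap (k l : 'I_n) : l \in J -> c k != c l -> (k < l)%N -> (k.+1 < l)%N.
  rewrite inE => lJ ckl kl; rewrite ltn_neqAle kl andbT.
  apply: contra ckl => /eqP kl1; move: lJ; rewrite -kl1 /= => /eqP <-.
  by apply/eqP; congr c; apply/val_inj; rewrite /= -kl1.
have far : (i.+1 < j)%N || (j.+1 < i)%N.
  case: (ltngtP i j) => [||/val_inj ij]; last by rewrite ij eqxx in cij.
    by move/(gap _ _ jJ cij) => ->.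
  by rewrite eq_sym in cij; move/(gap _ _ iJ cij) => ->; rewrite orbT.
have com : commute (simple_refl i) (simple_refl j).
  apply: signed_fix_commute => k.
  have [/andP[ki kpi]|nk] := boolP ((k != i) && (k != ord_prev i)).
    by rewrite simple_refl_fix.
  rewrite (@simple_refl_fix _ j) ?orbT // -val_eqE /=;
    move: nk far; rewrite -!val_eqE /=; lia.
rewrite -leqNgt dvdn_leq // order_dvdn expgMn // !expgS !expg0 !mulg1.
by rewrite !simple_refl_sqr mulg1.
Qed.

Lemma coxeter_edge_sym (gT : finGroupType) (A : {set gT}) :
  symmetric (coxeter_edge A).
Proof.
move=> s t; rewrite /coxeter_edge /=; case: (s \in A); case: (t \in A) => //=.
by rewrite -(orderJ (s * t)%g s) conjgE mulgA mulKg.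
Qed.

(** The positions of J of one color are consecutive, and adjacent simple reflections do not
    commute. *)
Lemma std_gens_connect i j : i \in J -> j \in J ->
  connect (coxeter_edge S) (g i) (g j) = (c i == c j).
Proof.
move=> iJ jJ; apply/connectP/eqP => [[p]|cij].
  elim: p i iJ => [|x p IHp] i iJ /=; first by move=> _ /std_gens_inj ->.
  move=> /andP[Ex px]; have : x \in S by case/and3P: Ex.
  rewrite std_gensE => /imsetP[k kJ xk]; rewrite xk in Ex px *.
  by rewrite (std_gens_edge_color iJ kJ Ex); apply: IHp.
apply/connectP.
have gS k : k \in J -> g k \in S by rewrite std_gensE => kJ; apply: imset_f.
wlog ij : i j iJ jJ cij / (i <= j)%N.
  move=> H; case: (leqP i j) => [|/ltnW]; first exact: H.
  rewrite (sym_connect_sym (@coxeter_edge_sym _ _)); exact: H.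
case: j jJ cij ij => j; elim: j => [|j IHj] ltjn jJ cij ij.
  by have -> : i = Ordinal ltjn by apply/val_inj/eqP; rewrite /= -leqn0.
move: ij; rewrite /= leq_eqVlt => /predU1P[ij|]; last rewrite ltnS => ij.
  by have -> : i = Ordinal ltjn by apply/val_inj.
pose k : 'I_n := Ordinal (ltnW ltjn).
have ck : c k = c (Ordinal ltjn).
  by apply/eqP; rewrite eqn_leq c_mono /= ?leqnSn // -cij c_mono.
have kJ : k \in J.
  move: ij; rewrite leq_eqVlt => /predU1P[ik|ltik].
    by have <- : i = k by apply/val_inj.
  have k0 : (k == 0%N :> nat) = false by apply/negbTE; rewrite -lt0n (leq_ltn_trans _ ltik).
  rewrite inE k0 eqn_leq c_mono ?leq_pred //= ck -cij c_mono //=.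
  by rewrite -ltnS prednK // (leq_ltn_trans _ ltik).
apply: connect_trans (IHj _ kJ _ ij) _; first by rewrite ck.
apply: connect1; apply/and3P; split; [exact: gS|exact: gS|].
rewrite -conjMg orderJ; exact: adjacent_simple_refl_order.
Qed.

(** Each component is the trace of a block on J. That trace is the whole zero block, or a nonzero
    block without its first position, which shifts the parity. *)
Lemma std_gens_components_even :
  [forall C in equivalence_partition (connect (coxeter_edge S)) S, ~~ odd #|C|] =
  [forall i, odd #|color_block v i| == (v i != 0)].
Proof.
have memS y : (y \in S) = (y \in g @: J) by rewrite std_gensE.
have compE i : i \in J -> [set y in S | connect (coxeter_edge S) (g i) y] =
    g @: (color_block v i :&: J).
  move=> iJ; apply/setP => y; rewrite inE memS; apply/andP/imsetP.
    case=> /imsetP[j jJ ->]; rewrite std_gens_connect // => cij.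
    by exists j; rewrite // inE std_block eq_sym cij.
  case=> j; rewrite inE std_block => /andP[cij jJ] ->.
  by rewrite imset_f // std_gens_connect // eq_sym.
have evenE i : (odd #|color_block v i| == (v i != 0)) = ~~ odd #|color_block v i :&: J|.
  by rewrite odd_std_block //; case: (odd _); case: (v i != 0).
apply/forall_inP/forallP => [evC i|ev C].
  rewrite evenE; have [->|[j]] := set_0Vmem (color_block v i :&: J).
    by rewrite cards0.
  rewrite inE std_block => /andP[/eqP cj jJ].
  have -> : color_block v i = color_block v j.
    by apply/setP => k; rewrite !std_block cj.
  rewrite -(card_imset _ std_gens_inj) -compE //; apply: evC.
  by apply/imsetP; exists (g j); rewrite // memS imset_f.
move=> /imsetP[x]; rewrite memS => /imsetP[i iJ ->] ->.
by rewrite compE // card_imset -?evenE //; apply: std_gens_inj.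
Qed.

End StandardComponents.

(** * Rank and components of an arbitrary color stabilizer *)

Section CoxeterShape.
Variable n : nat.
Implicit Types (v : 'I_n -> int) (S : {set signed_perm n}).

(** Since [coxeter_generators] is an arbitrary choice, every admissible S must be described, not
    just one. *)
Lemma coxeter_generatingP v S : coxeter_generating (color_stab v) S ->
  exists (c : 'I_n -> nat) (w : signed_perm n), [/\ {homo c : i j / (i <= j)%N},
    S = ((simple_refl @: std_index c)%SET :^ w)%g &
    color_stab v = color_stab (signed_act (std_coloring c) w)].
Proof.
case/andP => /eqP genS /existsP[w /existsP[I /andP[subI /eqP defS]]].
pose J := [set j | simple_refl j \in I].
(* This coloring increases exactly at the positions outside J, so that its [std_index] is J. *)
pose c (i : 'I_n) := #|[set j : 'I_n | (j <= i)%N && (j \notin J)]|.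
have defI : I = (simple_refl @: J)%SET.
  apply/setP => x; apply/idP/imsetP => [xI|[j]]; last by rewrite inE => jI ->.
  have := subsetP subI x xI; rewrite simple_reflectionsE => /imsetP[j _ xj].
  by exists j; rewrite // inE -xj.
have c_mono : {homo c : i j / (i <= j)%N}.
  move=> i j ij; apply/subset_leq_card/subsetP => k; rewrite !inE => /andP[ki ->].
  by rewrite (leq_trans ki).
have cS (i : 'I_n) : c i = ((i \notin J) + #|[set j : 'I_n | (j < i)%N && (j \notin J)]|)%N.
  rewrite /c (cardsD1 i) inE leqnn /=; congr (_ + _)%N; apply: eq_card => j.
  by rewrite !inE -val_eqE /= ltn_neqAle andbA.
have defJ : std_index c = J.
  apply/setP => j; rewrite [LHS]inE; case: ifP => j0.
    rewrite cS (_ : [set _ | _] = set0) ?cards0 ?addn0; first by case: (j \in J).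
    by apply/setP => k; rewrite !inE (eqP j0) ltn0.
  rewrite (cS j) (_ : [set _ | _] = [set k : 'I_n | (k <= ord_prev j)%N && (k \notin J)]).
    by rewrite -/(c _) -[X in X == _]add0n eqn_add2r; case: (j \in J).
  by apply/setP => k; rewrite !inE /= -[in RHS]ltnS prednK // lt0n j0.
exists c, w; split=> //; first by rewrite defJ -defI.
by rewrite color_stabJ -gen_std // defJ -defI -genJ -defS genS.
Qed.

Lemma coxeter_generating_exists v :
  exists S, coxeter_generating (color_stab v) S.
Proof.
have [c [w [c_mono ->]]] := color_sort v.
exists ((simple_refl @: std_index c)%SET :^ w)%g; rewrite /coxeter_generating.
rewrite color_stabJ -gen_std // -genJ eqxx /=.
apply/existsP; exists w; apply/existsP; exists (simple_refl @: std_index c)%SET.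
rewrite eqxx andbT simple_reflectionsE; apply/subsetP => x /imsetP[j _ ->].
exact: imset_f.
Qed.

Lemma coxeter_generatorsP v :
  coxeter_generating (color_stab v) (coxeter_generators (color_stab v)).
Proof.
rewrite /coxeter_generators; case: pickP => //= no.
by have [S] := coxeter_generating_exists v; rewrite no.
Qed.

Lemma coxeter_rank_color v :
  (coxeter_rank (color_stab v) + #|color_blocks v|)%N = n.
Proof.
have [c [w [c_mono defS eqv]]] := coxeter_generatingP (coxeter_generatorsP v).
rewrite /coxeter_rank defS (color_stab_eq_blocks eqv) card_signed_act_blocks.
exact: card_std_gens.
Qed.

(* When [v i = 0], [color_block v i] is the zero block.                       *)
Definition even_coloring v : bool :=
  [forall i, odd #|color_block v i| == (v i != 0)].

Lemma irreducible_components_even v :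
  [forall C in irreducible_components (color_stab v), ~~ odd #|C|] = even_coloring v.
Proof.
have [c [w [c_mono defS eqv]]] := coxeter_generatingP (coxeter_generatorsP v).
rewrite /irreducible_components defS std_gens_components_even //.
apply/forallP/forallP => ev i.
  rewrite (color_stab_eq_block eqv) (color_stab_eq0 eqv) -[i](permKV w.2).
  by rewrite card_signed_act_block signed_act_eq0.
have := ev (w.2 i); rewrite (color_stab_eq_block eqv) (color_stab_eq0 eqv).
by rewrite card_signed_act_block signed_act_eq0.
Qed.

End CoxeterShape.

(** * Parabolic subgroups as signed partitions *)

Section SignedPartitions.
Variable n : nat.
Implicit Types (Z : {set 'I_n}) (P : {set {set 'I_n}}) (e : {ffun 'I_n -> bool}).
Implicit Types (v : 'I_n -> int) (i j k : 'I_n).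

(** The choice depends only on the block, so all elements of a block share their representative. *)
Definition block_rep P i : 'I_n := odflt i [pick j in pblock P i].

(* [(Z, P, e)]: the zero block, the partition of its complement into the other *)
(* blocks, and the signs relative to a representative of each block.           *)
Definition signed_partition : Type :=
  ({set 'I_n} * {set {set 'I_n}} * {ffun 'I_n -> bool})%type.

HB.instance Definition _ := Finite.on signed_partition.

Implicit Types d : signed_partition.

(** The successor keeps the colors of blocks nonzero, and representatives keep them distinct. *)
Definition partition_coloring d i : int :=
  if i \in d.1.1 then 0 else (-1) ^+ d.2 i * (block_rep d.1.2 i).+1%:Z.

(** Signs are normalized on the zero block and at representatives, so that each subgroup has one
    description. *)
Definition is_signed_partition d : bool :=
  partition d.1.2 (~: d.1.1) &&
  [forall i, (i \in d.1.1) || (i == block_rep d.1.2 i) ==> ~~ d.2 i].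

Lemma mem_block_rep P Z i : partition P (~: Z) -> i \notin Z ->
  block_rep P i \in pblock P i.
Proof.
move=> parP iZ; rewrite /block_rep; case: pickP => [//|/(_ i)].
by rewrite mem_pblock (cover_partition parP) inE iZ.
Qed.

Lemma eq_block_rep P Z i j : partition P (~: Z) -> i \notin Z -> j \notin Z ->
  (block_rep P i == block_rep P j) = (pblock P i == pblock P j).
Proof.
move=> parP iZ jZ; have tP := partition_trivIset parP.
apply/eqP/eqP => [E|].
  have := mem_block_rep parP iZ; rewrite E => /(same_pblock tP) <-.
  exact/(same_pblock tP)/(mem_block_rep parP).
rewrite /block_rep => E; rewrite E; case: pickP => // /(_ j).
by rewrite mem_pblock (cover_partition parP) inE jZ.
Qed.

Lemma block_rep_notin P Z i : partition P (~: Z) -> i \notin Z ->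
  block_rep P i \notin Z.
Proof.
move=> parP iZ; rewrite -in_setC -(cover_partition parP).
apply/bigcupP; exists (pblock P i); last exact: (mem_block_rep parP iZ).
by rewrite pblock_mem // (cover_partition parP) inE.
Qed.

Lemma pblock_rep P Z i : partition P (~: Z) -> i \notin Z ->
  pblock P (block_rep P i) = pblock P i.
Proof.
by move=> parP iZ; apply/(same_pblock (partition_trivIset parP))/(mem_block_rep parP).
Qed.

Lemma block_rep_id P Z i : partition P (~: Z) -> i \notin Z ->
  block_rep P (block_rep P i) = block_rep P i.
Proof.
move=> parP iZ; apply/eqP; rewrite (eq_block_rep parP) ?(block_rep_notin parP) //.
by rewrite (pblock_rep parP).
Qed.

Lemma eq_signed_succ (s t : bool) (a b : nat) :
  ((-1) ^+ s * a.+1%:Z == (-1) ^+ t * b.+1%:Z) = (a == b) && (s == t).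
Proof. by case: s; case: t; rewrite ?expr1 ?expr0; apply/eqP/andP; lia. Qed.

Lemma partition_coloring_eq0 d i : (partition_coloring d i == 0) = (i \in d.1.1).
Proof.
by rewrite /partition_coloring; case: ifP => _ //; rewrite mulf_eq0 signr_eq0.
Qed.

Lemma partition_coloring_eq d i j (s : bool) : is_signed_partition d ->
  (partition_coloring d i == (-1) ^+ s * partition_coloring d j) =
  if i \in d.1.1 then j \in d.1.1 else
    [&& j \notin d.1.1, pblock d.1.2 i == pblock d.1.2 j & s == d.2 i (+) d.2 j].
Proof.
case/andP => parP _; have [iZ|iZ] := ifP.
  have /eqP-> : partition_coloring d i == 0 by rewrite partition_coloring_eq0.
  by rewrite eq_sym mulf_eq0 signr_eq0 partition_coloring_eq0.
have [jZ|jZ] /= := boolP (j \in d.1.1).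
  have /eqP-> : partition_coloring d j == 0 by rewrite partition_coloring_eq0.
  by rewrite mulr0 partition_coloring_eq0 iZ.
rewrite /partition_coloring iZ (negPf jZ) mulrA -signr_addb eq_signed_succ.
rewrite val_eqE (eq_block_rep parP) ?iZ //; congr (_ && _).
by case: s; case: (d.2 i); case: (d.2 j).
Qed.

(** Here [sim i j s] abstracts x_i = (-1)^s x_j. The indices with x_i = - x_i form Z, the others are
    grouped by relation up to sign, and e compares each with its representative. *)
Lemma signed_partition_of_rel (sim : 'I_n -> 'I_n -> bool -> bool) :
    (forall i, sim i i false) ->
    (forall i j s, sim i j s -> sim j i s) ->
    (forall i j k s t, sim i j s -> sim j k t -> sim i k (s (+) t)) ->
    (forall i j s, sim i i true -> sim j j true -> sim i j s) ->
  exists2 d, is_signed_partition d & forall i j (s : bool),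
    (partition_coloring d i == (-1) ^+ s * partition_coloring d j) = sim i j s.
Proof.
move=> refl sym trans zero.
pose Z := [set i | sim i i true].
pose r i j := sim i j false || sim i j true.
have r_ex i j : r i j -> exists s, sim i j s by case/orP; eexists; eassumption.
have r_in i j s : sim i j s -> r i j by rewrite /r; case: s => ->; rewrite ?orbT.
have r_eqv : {in ~: Z & &, equivalence_rel r}.
  move=> i j k _ _ _; split=> [|/r_ex[s ij]]; first by apply: r_in (refl k).
  by apply/idP/idP => /r_ex[t jk]; apply/r_in/(trans _ _ _ _ _ _ jk);
    [exact: sym _ _ _ ij|exact: ij].
pose P := equivalence_partition r (~: Z).
have parP : partition P (~: Z) by apply: equivalence_partitionP.
pose e := [ffun i => (i \notin Z) && sim i (block_rep P i) true].
have sim_rep i : i \notin Z -> sim i (block_rep P i) (e i).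
  move=> iZ; have := mem_block_rep parP iZ.
  have riZ := block_rep_notin parP iZ.
  rewrite pblock_equivalence_partition ?in_setC // /r /e ffunE iZ /=.
  by case: (boolP (sim i (block_rep P i) true)); rewrite ?orbF.
have d_valid : is_signed_partition (Z, P, e).
  rewrite /is_signed_partition parP /=; apply/forallP => i; rewrite ffunE /=.
  case: (boolP (i \in Z)) => //= iZ; apply/implyP => /eqP <-.
  by move: iZ; rewrite inE.
exists (Z, P, e) => // i j s; rewrite partition_coloring_eq //=.
have [iZ|iZ] := boolP (i \in Z).
  apply/idP/idP => [jZ|ij]; first by move: iZ jZ; rewrite !inE; apply: zero.
  rewrite !inE in iZ *; have := trans _ _ _ _ _ (trans _ _ _ _ _ (sym _ _ _ ij) iZ) ij.
  by rewrite addbAC addbb.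
have [jZ|jZ] /= := boolP (j \in Z).
  apply/esym/negP => ij; case/negP: iZ; rewrite !inE in jZ *.
  have := trans _ _ _ _ _ (trans _ _ _ _ _ ij jZ) (sym _ _ _ ij).
  by rewrite addbAC addbb.
apply/andP/idP => [[]|ij].
  rewrite -(eq_block_rep parP) // => /eqP rij /eqP->.
  apply: trans _ _ _ _ _ (sim_rep i iZ) _; rewrite rij; exact/sym/sim_rep.
have Pij : pblock P i = pblock P j.
  apply/esym/(same_pblock (partition_trivIset parP)).
  by rewrite pblock_equivalence_partition ?in_setC // (r_in _ _ _ ij).
have rij : block_rep P i = block_rep P j.
  by apply/eqP; rewrite (eq_block_rep parP) // Pij.
split; first by rewrite Pij.
have sj : sim (block_rep P i) j (e j) by rewrite rij; apply/sym/sim_rep.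
(* A wrong sign would relate i to its own negative and put it in Z. *)
have := trans _ _ _ _ _ ij (sym _ _ _ (trans _ _ _ _ _ (sim_rep i iZ) sj)).
move: iZ; rewrite inE /=.
by case: s ij (e i) (e j) => [] _ [] [] //= /negPf->.
Qed.

End SignedPartitions.

(** * The correspondence with parabolic subgroups *)

Section ParabolicSubgroups.
Variable n : nat.
Implicit Types (v : 'I_n -> int) (i j : 'I_n) (d : signed_partition n).
Implicit Type w : signed_perm n.

Lemma signed_mx_fix (R : realType) (x : 'rV[R]_n) w :
  (x *m signed_mx R w = x) <-> (forall i, x 0 i = (-1) ^+ w.1 i * x 0 (w.2 i)).
Proof.
have mulE i : (x *m signed_mx R w) 0 (w.2 i) = (-1) ^+ w.1 i * x 0 i.
  rewrite mulmxA mul_mx_diag mxE (bigD1 i) //= big1 ?addr0 => [|k ki].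
    by rewrite !mxE eqxx mulr1 mulrC.
  by rewrite !mxE (inj_eq perm_inj) (negPf ki) mulr0.
split=> [E i|E]; first by rewrite -[in RHS]E mulE mulrA -expr2 sqrr_sign mul1r.
apply/rowP => j; rewrite -[j](permKV w.2) mulE [in LHS]E.
by rewrite mulrA -expr2 sqrr_sign mul1r.
Qed.

(** The subspace is the line spanned by v. *)
Lemma parabolic_color_stab (R : realType) v : parabolic R (color_stab_group v).
Proof.
pose x : 'rV[R]_n := \row_i (v i)%:~R.
exists <[x]>%VS; apply/setP => w; apply/color_stabP/idP => [vw|].
  rewrite inE; apply/asboolP => _ /vlineP[a ->].
  rewrite -scalemxAl; congr (_ *: _); apply/signed_mx_fix => i; rewrite !mxE vw.
  by rewrite rmorphM rmorphXn rmorphN1.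
rewrite inE => /asboolP/(_ x (memv_line x))/signed_mx_fix xw i; have := xw i.
rewrite !mxE => E; apply: (@intr_inj R).
by rewrite rmorphM rmorphXn rmorphN1.
Qed.

Lemma parabolic_signed_partition (R : realType) (H : {group signed_perm n}) :
  parabolic R H ->
  exists2 d, is_signed_partition d & H = color_stab_group (partition_coloring d).
Proof.
case=> U defH.
pose sim i j (s : bool) := `[< forall x : 'rV[R]_n, x \in U -> x 0 i = (-1) ^+ s * x 0 j >].
have [] := @signed_partition_of_rel n sim.
- by move=> i; apply/asboolP => x _; rewrite mul1r.
- move=> i j s /asboolP ij; apply/asboolP => x xU.
  by rewrite (ij x xU) mulrA -expr2 sqrr_sign mul1r.
- move=> i j k s t /asboolP ij /asboolP jk; apply/asboolP => x xU.
  by rewrite (ij x xU) (jk x xU) mulrA signr_addb.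
- move=> i j s /asboolP i0 /asboolP j0; apply/asboolP => x xU.
  move: (i0 x xU) (j0 x xU); rewrite expr1 !mulN1r => xi xj.
  have {xi} -> : x 0 i = 0 by lra.
  by have {xj} -> : x 0 j = 0; [lra|rewrite mulr0].
move=> d dP simE; exists d => //; apply/val_inj; rewrite /= defH.
apply/setP => w; rewrite [in LHS]inE; apply/asboolP/color_stabP => [wU i|wd x xU].
  by apply/eqP; rewrite simE; apply/asboolP => x /wU/signed_mx_fix.
apply/signed_mx_fix => i; have /eqP := wd i; rewrite simE => /asboolP; exact.
Qed.

(** The relations give back Z, then P, and finally e, by comparing each position with its
    representative, where the sign is normalized. *)
Lemma signed_partition_inj : {in [pred d | is_signed_partition d] &,
  injective (fun d => color_stab (partition_coloring d))}.
Proof.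
move=> [[Z P] e] [[Z' P'] e'] /= dP dP' /color_stab_eqP E.
have {}E i j s := E i j s; have EZ : Z = Z'.
  apply/setP => i; have := E i i true; rewrite !partition_coloring_eq //=.
  by rewrite !addbb !andbF; case: (i \in Z); case: (i \in Z').
rewrite -EZ in dP' E *.
have [parP /= eP] := andP dP; have [parP' /= eP'] := andP dP'.
have tP := partition_trivIset parP; have tP' := partition_trivIset parP'.
have eqE i j (s : bool) : i \notin Z -> j \notin Z ->
    (pblock P i == pblock P j) && (s == e i (+) e j) =
    (pblock P' i == pblock P' j) && (s == e' i (+) e' j).
  by move=> iZ jZ; have := E i j s; rewrite !partition_coloring_eq //= (negPf iZ) jZ.
have eq_block i j : i \notin Z -> j \notin Z ->
    (pblock P i == pblock P j) = (pblock P' i == pblock P' j).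
  move=> iZ jZ; apply/idP/idP => Pij.
    by have := eqE i j (e i (+) e j) iZ jZ; rewrite Pij eqxx => /esym/andP[].
  by have := eqE i j (e' i (+) e' j) iZ jZ; rewrite Pij eqxx => /andP[].
have in_blockE Q i j : partition Q (~: Z) -> i \notin Z ->
    (j \in pblock Q i) = (j \notin Z) && (pblock Q i == pblock Q j).
  move=> parQ iZ; have iQ : i \in cover Q by rewrite (cover_partition parQ) inE.
  rewrite (eq_pblock _ (partition_trivIset parQ) iQ); case: (boolP (j \in Z)) => //= jZ.
  apply/negP => jQ; move: jZ; apply/negP; rewrite -in_setC -(cover_partition parQ).
  by apply/bigcupP; exists (pblock Q i); rewrite ?pblock_mem.
have blockE i : i \notin Z -> pblock P i = pblock P' i.
  move=> iZ; apply/setP => j; rewrite !in_blockE //.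
  by case: (boolP (j \in Z)) => //= jZ; rewrite eq_block.
have imE Q : partition Q (~: Z) -> Q = pblock Q @: ~: Z.
  move=> parQ; apply/setP => B; apply/idP/imsetP => [BQ|[i iZ ->]].
    have /set0Pn[i iB] := partition_neq0 parQ BQ; exists i.
      by rewrite -(cover_partition parQ); apply/bigcupP; exists B.
    by rewrite (def_pblock (partition_trivIset parQ) BQ iB).
  by rewrite pblock_mem // (cover_partition parQ).
have EP : P = P'.
  rewrite (imE P parP) (imE P' parP'); apply: eq_in_imset => i.
  by rewrite inE => /blockE.
rewrite -EP in dP' eP' eqE *; congr (_, _, _); apply/ffunP => i.
have [iZ|iZ] := boolP (i \in Z).
  by move: (forallP eP i) (forallP eP' i); rewrite /= iZ /= => /negPf-> /negPf->.
have rZ := block_rep_notin parP iZ.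
move: (forallP eP (block_rep P i)) (forallP eP' (block_rep P i)).
rewrite /= !(block_rep_id parP iZ) eqxx orbT /= => /negPf er /negPf er'.
have := eqE i (block_rep P i) (e i) iZ rZ.
by rewrite (pblock_rep parP iZ) eqxx er er' !addbF eqxx => /esym/eqP.
Qed.

End ParabolicSubgroups.

(** * Weighted sums over the subgroups below a coloring *)

Section SumsOverParabolics.
Variable n : nat.
Implicit Types (v : 'I_n -> int) (i j : 'I_n) (d : signed_partition n).
Implicit Types (Z B : {set 'I_n}) (P : {set {set 'I_n}}).

Definition allowed_signs v Z P i : pred bool :=
  fun b => if (i \in Z) || (i == block_rep P i) then ~~ b
           else v i == (-1) ^+ b * v (block_rep P i).

(* The number of choices of signs on the block B, relative to its             *)
(* representative, that are compatible with v.                                *)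
Definition sign_count v B : nat :=
  \prod_(i in B) #|[pred b : bool | if Some i == [pick j in B] then ~~ b
                     else (v i == (-1) ^+ b * v (odflt i [pick j in B]))%R]|.

(** Comparing each position with its representative is enough, so the condition on e is independent
    from one position to another. *)
Lemma signed_partition_below v Z P (e : {ffun 'I_n -> bool}) :
  is_signed_partition (Z, P, e) &&
    (color_stab (partition_coloring (Z, P, e)) \subset color_stab v) =
  (Z \subset [set i | v i == 0]) && partition P (~: Z) &&
    (e \in family (allowed_signs v Z P)).
Proof.
apply/andP/idP => [[dP /color_stabS sub]|].
  have [parP /forallP eP] := andP dP; rewrite /= in parP eP.
  have ZE : Z \subset [set i | v i == 0].
    apply/subsetP => i iZ; rewrite inE.
    have /sub : partition_coloring (Z, P, e) i =
        (-1) ^+ true * partition_coloring (Z, P, e) i.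
      by apply/eqP; rewrite partition_coloring_eq //= iZ.
    by rewrite expr1 mulN1r => vi; apply/eqP; lia.
  rewrite ZE parP; apply/familyP => i; rewrite unfold_in /allowed_signs.
  case: ifP => [|/norP[iZ ir]]; first by move: (eP i) => /implyP.
  have rZ := block_rep_notin parP iZ.
  apply/eqP/sub/eqP; rewrite partition_coloring_eq //= (negPf iZ) rZ.
  rewrite (pblock_rep parP iZ) eqxx /=.
  have := eP (block_rep P i); rewrite (block_rep_id parP iZ) eqxx orbT => /negPf->.
  by rewrite addbF.
case/andP => /andP[ZE parP] /familyP eF.
have dP : is_signed_partition (Z, P, e).
  rewrite /is_signed_partition parP; apply/forallP => i; apply/implyP => /= iZr.
  by have := eF i; rewrite unfold_in /allowed_signs iZr.
split=> //; apply/color_stabS => i j s /eqP; rewrite partition_coloring_eq //=.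
have v0 k : k \in Z -> v k = 0 by move/(subsetP ZE); rewrite inE => /eqP.
have [iZ jZ|iZ /and3P[jZ /eqP Pij /eqP->]] := ifP; first by rewrite !v0 ?mulr0.
have vE k : k \notin Z -> v k = (-1) ^+ e k * v (block_rep P k).
  move=> kZ; have := eF k; rewrite unfold_in /allowed_signs (negPf kZ) /=.
  by case: ifP => [/eqP<- /negPf->|_ /eqP //]; rewrite mul1r.
have -> : v i = (-1) ^+ e i * v (block_rep P i) by apply: vE; rewrite iZ.
rewrite (vE j jZ) signr_addb mulrA -(mulrA _ _ ((-1) ^+ e j)) -expr2 sqrr_sign mulr1.
congr (_ * v _).
by apply/eqP; rewrite (eq_block_rep parP) ?iZ // Pij.
Qed.

Lemma card_allowed_signs v Z P : partition P (~: Z) ->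
  #|family (allowed_signs v Z P)| = (\prod_(B in P) sign_count v B)%N.
Proof.
move=> parP; have tP := partition_trivIset parP.
have -> : #|family (allowed_signs v Z P)| = (\prod_i #|allowed_signs v Z P i|)%N.
  rewrite card_family /image_mem foldrE big_map.
  by rewrite big_enum.
rewrite (bigID [in Z]) /= big1 ?mul1n => [|i iZ]; last first.
  rewrite (eq_card (B := pred1 false)) ?card1 // => b.
  by rewrite unfold_in /allowed_signs iZ; case: b.
rewrite (eq_bigl [in cover P]) => [|i]; last by rewrite (cover_partition parP) inE.
rewrite big_trivIset //; apply: eq_bigr => B BP; apply: eq_bigr => i iB.
have iZ : i \notin Z.
  by rewrite -in_setC -(cover_partition parP); apply/bigcupP; exists B.
have pB := def_pblock tP BP iB.
have repE : Some (block_rep P i) = [pick j in B].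
  by rewrite /block_rep pB; case: pickP => // /(_ i); rewrite iB.
apply: eq_card => b; rewrite [LHS]unfold_in inE /allowed_signs (negPf iZ) /=.
by rewrite -repE.
Qed.

(** The weight ignores e, so summing over e multiplies it by the number of admissible signs, a
    product over blocks. *)
Lemma sum_signed_partitions (K : comNzRingType) (b a : nat -> K) v :
  \sum_(d | is_signed_partition d &&
            (color_stab (partition_coloring d) \subset color_stab v))
     b #|d.1.1| * \prod_(B in d.1.2) a #|B| =
  \sum_(Z : {set 'I_n} | Z \subset [set i | v i == 0])
     b #|Z| * partition_sum (fun B => a #|B| * (sign_count v B)%:R) (~: Z).
Proof.
under [RHS]eq_bigr => Z _ do rewrite /partition_sum mulr_sumr.
rewrite pair_big_dep /=.
transitivity (\sum_(p : {set 'I_n} * {set {set 'I_n}} |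
    (p.1 \subset [set i | v i == 0]) && partition p.2 (~: p.1))
    \sum_(e in family (allowed_signs v p.1 p.2))
      b #|p.1| * \prod_(B in p.2) a #|B|).
  rewrite pair_big_dep /=; apply: eq_bigl => -[[Z P] e] /=.
  exact: signed_partition_below.
apply: eq_bigr => -[Z P] /= /andP[_ parP].
rewrite sumr_const card_allowed_signs // big_split /= -natr_prod.
by rewrite mulrA mulr_natr.
Qed.

Lemma sign_count_zero v B : B != set0 -> {in B, forall i, v i = 0} ->
  sign_count v B = (2 ^ #|B|.-1)%N.
Proof.
move=> /set0Pn[x xB] v0; rewrite /sign_count; case: pickP => [r rB|/(_ x)]; last by rewrite xB.
rewrite (bigD1 r) //= (eq_card (B := pred1 false)) => [|b]; last first.
  by rewrite !inE eqxx; case: b.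
rewrite card1 mul1n (eq_bigr (fun=> 2%N)) => [|i /andP[iB ir]].
  rewrite (eq_bigl [in B :\ r]) => [|i]; last by rewrite !inE andbC.
  by rewrite prod_nat_const (cardsD1 r B) rB.
rewrite -card_bool; apply: eq_card => b.
rewrite !inE (inj_eq Some_inj) (negPf ir).
by rewrite !v0 // mulr0 eqxx.
Qed.

Lemma sign_count_block v B i0 : v i0 != 0 -> B \subset color_block v i0 ->
  sign_count v B = 1%N.
Proof.
move=> v0 sB; rewrite /sign_count big1 // => i iB.
case: pickP => [r rB|/(_ i)]; last by rewrite iB.
have: `|v i|%N == `|v i0|%N by have := subsetP sB i iB; rewrite inE.
have: `|v r|%N == `|v i0|%N by have := subsetP sB r rB; rewrite inE.
have [|] := eqVneq (Some i) (Some r) => ir vr vi.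
  by rewrite (eq_card (B := pred1 false)) ?card1 // => -[].
rewrite (eq_card (B := pred1 (v i != v r))) ?card1 // => -[];
  rewrite !inE [RHS]eq_sym ?eqb_id ?eqbF_neg /= ?expr1 ?mulN1r ?mul1r; lia.
Qed.

Lemma sign_count_cross v B i j : i \in B -> j \in B -> `|v i|%N != `|v j|%N ->
  sign_count v B = 0%N.
Proof.
move=> iB jB vij; rewrite /sign_count; case: pickP => [r rB|/(_ i)]; last by rewrite iB.
have [k kB vkr] : exists2 k, k \in B & `|v k|%N != `|v r|%N.
  have [E|] := eqVneq `|v i|%N `|v r|%N; last by exists i.
  by exists j; rewrite // -E eq_sym.
apply/eqP; rewrite (bigD1 k) //= muln_eq0; apply/orP; left; apply/eqP/eq_card0 => b.
rewrite inE (inj_eq Some_inj); have [E|_] := eqVneq k r.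
  by rewrite E eqxx in vkr.
by apply: contraNF vkr => /eqP->; rewrite abszMsign.
Qed.

End SumsOverParabolics.

(** * The Moebius function *)

Section PartitionColoringBlocks.
Variable n : nat.
Implicit Types (v : 'I_n -> int) (i j : 'I_n) (d : signed_partition n).

Lemma partition_coloring_block d i : is_signed_partition d ->
  color_block (partition_coloring d) i =
  if i \in d.1.1 then d.1.1 else pblock d.1.2 i.
Proof.
move=> dP; have [parP _] := andP dP; have tP := partition_trivIset parP.
have PZ j : (j \in cover d.1.2) = (j \notin d.1.1).
  by rewrite (cover_partition parP) inE.
apply/setP => j; rewrite inE eq_sym eq_abszE; case: ifP => iZ.
  apply/existsP/idP => [[s]|jZ]; first by rewrite partition_coloring_eq // iZ.
  by exists false; rewrite partition_coloring_eq // iZ.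
apply/existsP/idP => [[s]|ij].
  rewrite partition_coloring_eq // iZ => /and3P[jZ Pij _].
  by rewrite -eq_pblock ?PZ ?iZ.
have jZ : j \notin d.1.1.
  by rewrite -PZ; apply/bigcupP; exists (pblock d.1.2 i); rewrite ?pblock_mem ?PZ ?iZ.
exists (d.2 i (+) d.2 j); rewrite partition_coloring_eq // iZ jZ eqxx andbT /=.
by rewrite eq_pblock ?PZ ?iZ.
Qed.

Lemma partition_coloring_blocks d : is_signed_partition d ->
  color_blocks (partition_coloring d) = d.1.2.
Proof.
move=> dP; have [parP _] := andP dP.
apply/setP => B; apply/imsetP/idP => [[i]|BP].
  rewrite inE partition_coloring_eq0 => iZ ->.
  by rewrite partition_coloring_block // (negPf iZ) pblock_mem // (cover_partition parP) inE.
have /set0Pn[i iB] := partition_neq0 parP BP.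
have iZ : i \notin d.1.1.
  by rewrite -in_setC -(cover_partition parP); apply/bigcupP; exists B.
exists i; first by rewrite inE partition_coloring_eq0.
rewrite partition_coloring_block // (negPf iZ).
by rewrite (def_pblock (partition_trivIset parP) BP iB).
Qed.

Lemma even_partition_coloringP d : is_signed_partition d ->
  reflect (~~ odd #|d.1.1| /\ {in d.1.2, forall B : {set _}, odd #|B|})
    (even_coloring (partition_coloring d)).
Proof.
move=> dP; have [parP _] := andP dP.
apply: (iffP forallP) => [ev|[evZ oddP] i].
  split=> [|B BP].
    have [->|[i iZ]] := set_0Vmem d.1.1; first by rewrite cards0.
    by have := ev i; rewrite partition_coloring_block // partition_coloring_eq0 iZ eqbF_neg.
  have /set0Pn[i iB] := partition_neq0 parP BP.
  have iZ : i \notin d.1.1.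
    by rewrite -in_setC -(cover_partition parP); apply/bigcupP; exists B.
  have := ev i; rewrite partition_coloring_block // partition_coloring_eq0 iZ (negPf iZ).
  by rewrite (def_pblock (partition_trivIset parP) BP iB) => /eqP.
rewrite partition_coloring_block // partition_coloring_eq0.
case: ifP => iZ; first by rewrite eqbF_neg.
by rewrite oddP // pblock_mem // (cover_partition parP) inE iZ.
Qed.

Lemma color_stab_trivial v :
  reflect (forall i, v i != 0 /\ color_block v i = [set i])
    (color_stab v == [set 1%g]).
Proof.
apply: (iffP eqP) => [v1 i|vE].
  have refl1 j (s : bool) : v i = (-1) ^+ s * v j -> (i == j) && ~~ s.
    move=> /eqP; rewrite -mem_signed_refl v1 inE => /eqP ij.
    have := congr1 (fun w : signed_perm n => w.2 i) ij.
    have := congr1 (fun w : signed_perm n => w.1 i) ij.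
    by rewrite signed_one2E signed_one1E /= ffunE eqxx andbT tpermL => -> ->; rewrite eqxx.
  split; first by apply/negP => /eqP vi; have := refl1 i true; rewrite vi mulr0 eqxx => /(_ erefl).
  apply/setP => j; rewrite !inE; apply/idP/eqP => [|->//].
  by rewrite eq_sym eq_abszE => /existsP[s /eqP/refl1/andP[/eqP]].
apply/setP => w; rewrite in_set1; apply/color_stabP/eqP => [vw|-> i]; last first.
  by rewrite signed_one1E signed_one2E mul1r.
have w2 i : w.2 i = i.
  have [_ bi] := vE i; apply/set1P; rewrite -bi inE eq_sym eq_abszE.
  by apply/existsP; exists (w.1 i); apply/eqP.
apply: signed_permP => i; rewrite ?signed_one1E ?signed_one2E //.
have := vw i; rewrite w2; have [vi _] := vE i; case: (w.1 i) => //.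
by rewrite expr1 mulN1r; lia.
Qed.

End PartitionColoringBlocks.

Lemma arcsinh'_odd (K : comNzRingType) (q : K) k : odd k -> arcsinh' q k = 0.
Proof.
by elim/ltn_ind: k => -[|[|k]] IHk //= /negPn/IHk ->; rewrite ?mulr0.
Qed.

(** Reflects exp (arcsinh x) = x + sqrt (1 + x^2): the factor 1 - k^2 of the recursion is 0 at k =
    1. *)
Lemma exp_arcsinh1_odd (K : comNzRingType) k :
  odd k -> (1 < k)%N -> exp_arcsinh (1 : K) k = 0.
Proof.
elim/ltn_ind: k => -[|[|[|[|k]]]] IHk //; first by rewrite /= => _ _; ring.
move=> k_odd _; rewrite -[LHS]/(_ * exp_arcsinh 1 k.+2).
case: k IHk k_odd => [//|k] IHk k_odd; rewrite IHk ?mulr0 //.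
by move: k_odd => /=; rewrite !negbK.
Qed.

(** The coefficient of x^k / k! in arcsinh x. The guard also gives 0 at k = 0, where the truncated
    predecessor would give 1. *)
Definition odd_block_mobius k : rat := if odd k then arcsinh' 1 k.-1 else 0.

Lemma arcsinh'4E k : arcsinh' 4 k = odd_block_mobius k.+1 * 2 ^+ k.
Proof.
rewrite /odd_block_mobius /=; case: ifP => [|/negbFE/arcsinh'_odd->]; last by rewrite mul0r.
elim/ltn_ind: k => -[|[|k]] IHk //.
rewrite /= negbK => k_even; rewrite IHk // !exprS.
by ring.
Qed.

(** * The product formula for the Moebius function *)

Section MobiusFunction.
Variable n : nat.
Implicit Types (v : 'I_n -> int) (i j : 'I_n) (d : signed_partition n).
Implicit Types (Z B : {set 'I_n}).

Definition partition_mobius d : rat :=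
  sech_arcsinh #|d.1.1| * \prod_(B in d.1.2) odd_block_mobius #|B|.

Lemma not_even_partition_weight0 (K : comNzRingType) (b a : nat -> K) d :
    is_signed_partition d -> (forall k, odd k -> b k = 0) ->
    (forall k, ~~ odd k -> a k = 0) -> ~~ even_coloring (partition_coloring d) ->
  b #|d.1.1| * \prod_(B in d.1.2) a #|B| = 0.
Proof.
move=> dP b0 a0; apply: contraNeq => nz; apply/even_partition_coloringP => //.
split=> [|B BP]; first by apply: contra nz => /b0->; rewrite mul0r.
by apply: contraNT nz => /a0 aB; rewrite (bigD1 B) //= aB mul0r mulr0.
Qed.

Lemma partition_mobius_eq0 d : is_signed_partition d ->
  ~~ even_coloring (partition_coloring d) -> partition_mobius d = 0.
Proof.
move=> dP; apply: not_even_partition_weight0 => // k k_odd.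
  by rewrite /sech_arcsinh k_odd.
by rewrite /odd_block_mobius (negPf k_odd).
Qed.

Let weight v B : rat := odd_block_mobius #|B| * (sign_count v B)%:R.

(** Blocks crossing the zero block have no admissible signs. Inside it, the 2^(|B|-1) sign choices
    replace x by 2 x in the derivative of arcsinh, which is [arcsinh' 4]. *)
Lemma partition_sum_zero_block v Z : Z \subset [set i | v i == 0] ->
  partition_sum (weight v) (~: Z) =
    exp_arcsinh 4 (#|[set i | v i == 0]| - #|Z|) *
    partition_sum (weight v) (~: [set i | v i == 0]).
Proof.
set Z0 := [set i | _] => ZZ0.
have -> : ~: Z = (Z0 :\: Z) :|: ~: Z0.
  apply/setP => i; rewrite !inE; have := subsetP ZZ0 i; rewrite inE.
  by case: (i \in Z) => [->|] //; case: (v i == 0).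
rewrite partition_sumU; last first.
- move=> B sB /subsetPn[i iB iZ0] /subsetPn[j jB jZ0].
  rewrite /weight (sign_count_cross iB jB) ?mulr0 //.
  have := subsetP sB i iB; rewrite in_setU (negPf iZ0) /= !inE => vi.
  by move: jZ0; rewrite !inE negbK => /eqP->; rewrite absz0 absz_eq0.
- by rewrite -setI_eq0 setIDAC setICr set0D.
congr (_ * _); rewrite -(setIidPr ZZ0) -cardsD setDIr setDv set0U.
apply: (partition_sum_card (g := arcsinh' 4)) => //; first exact: exp_arcsinhS.
move=> B sB B0; rewrite /weight (sign_count_zero B0) => [|i /(subsetP sB)]; last first.
  by rewrite !inE => /andP[_ /eqP].
rewrite arcsinh'4E natrX prednK // lt0n cards_eq0; exact: B0.
Qed.

(** The defining recursion of the Moebius function, extended to all signed partitions because those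
    outside the poset have weight 0. *)
Lemma sum_partition_mobius v : even_coloring v ->
  \sum_(d | is_signed_partition d &&
            (color_stab (partition_coloring d) \subset color_stab v))
     partition_mobius d = (color_stab v == [set 1%g])%:R.
Proof.
move=> /forallP ev; rewrite sum_signed_partitions -/(weight v).
set Z0 := [set i | v i == 0].
rewrite (eq_bigr (fun Z : {set 'I_n} => sech_arcsinh #|Z| * exp_arcsinh 4 (#|Z0| - #|Z|) *
  partition_sum (weight v) (~: Z0))) => [|Z ZZ0]; last first.
  by rewrite -mulrA -partition_sum_zero_block.
rewrite -mulr_suml (sum_subsets_card (fun k => sech_arcsinh k * exp_arcsinh 4 (#|Z0| - k))).
(* A nonempty zero block has even size, and the sum over Z vanishes. *)
have [Z00|[i iZ]] := set_0Vmem Z0; last first.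
  have vi : v i = 0 by apply/eqP; rewrite inE in iZ.
  rewrite sum_sech_exp_arcsinh ?mul0r.
  - by case: color_stab_trivial => // /(_ i)[]; rewrite vi.
  - have := ev i; rewrite vi eqxx eqbF_neg; congr (~~ odd _).
    by apply: eq_card => j; rewrite !inE vi absz_eq0.
  - by rewrite (cardD1 i) iZ.
have vN0 i : v i != 0.
  by apply/negP => vi; have := in_set0 i; rewrite -Z00 inE vi.
have sech0 : sech_arcsinh 0 = 1 by rewrite /sech_arcsinh /=; field.
rewrite Z00 cards0 big_ord1 bin0 sech0 !mul1r setC0.
(* For a trivial stabilizer only the partition into singletons contributes. *)
case: color_stab_trivial => [triv|ntriv].
  rewrite (partition_sum_card (g := fun k => (k == 0%N)%:R) (f := fun=> 1)) // => [k|B _ B0].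
    rewrite big_ord_recl big1 => [|i _]; rewrite ?mulr0 ?mul0r //.
    by rewrite bin0 !mulr1 addr0.
  have /set0Pn[i iB] := B0; have [B1|[j]] := set_0Vmem (B :\ i).
    have -> : B = [set i] by rewrite -(setD1K iB) B1 setU0.
    rewrite /weight cards1 (@sign_count_block _ _ _ i) ?mulr1 //.
    by rewrite sub1set color_block_refl.
  rewrite in_setD1 => /andP[ji jB].
  have -> : (#|B|.-1 == 0)%N = false.
    by rewrite (cardsD1 i) iB (cardsD1 j) !inE ji jB.
  rewrite /weight (sign_count_cross iB jB) ?mulr0 //.
  have [_ /setP/(_ j)] := triv i.
  by rewrite !inE (negPf ji) eq_sym => ->.
(* Otherwise some nonzero block has odd size above 1, and its factor, a coefficient of x + sqrt (1 +
   x^2), is 0. *)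
have [i bi] : exists i, color_block v i != [set i].
  apply/existsP; rewrite -negb_forall; apply/negP => /forallP bE.
  by apply: ntriv => i; split=> //; apply/eqP.
set C := color_block v i in bi.
have C_odd : odd #|C| by have := ev i; rewrite vN0 => /eqP.
have C_gt1 : (1 < #|C|)%N.
  rewrite ltn_neqAle eq_sym lt0n cards_eq0 andbC; apply/andP; split.
    by apply/set0Pn; exists i; apply: color_block_refl.
  apply: contra bi => /cards1P[x Cx]; have := color_block_refl v i.
  by rewrite -/C Cx inE => /eqP->.
have -> : [set: 'I_n] = C :|: ~: C by rewrite setUCr.
rewrite partition_sumU; last first.
- move=> B _ /subsetPn[j jB jC] /subsetPn[k kB]; rewrite inE negbK => kC.
  rewrite /weight (sign_count_cross jB kB) ?mulr0 //.
  by move: jC kC; rewrite !inE => jC /eqP->.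
- by rewrite -setI_eq0 setICr.
rewrite (partition_sum_card (g := arcsinh' 1) (f := exp_arcsinh 1)) //.
- by rewrite exp_arcsinh1_odd ?mul0r.
- exact: exp_arcsinhS.
move=> B BC B0; rewrite /weight (sign_count_block (vN0 i) BC) mulr1 /odd_block_mobius.
case: ifP => // /negbT; rewrite -[in ~~ _](prednK (n := #|B|)) /= ?negbK => [/arcsinh'_odd->//|].
by rewrite lt0n cards_eq0.
Qed.

Definition even_signed_partitions : {set signed_partition n} :=
  [set d | is_signed_partition d && even_coloring (partition_coloring d)].

Let stab d := color_stab_group (partition_coloring d).

Lemma PiB2E (R : realType) : PiB2 R n = stab @: even_signed_partitions.
Proof.
apply/setP => H; rewrite inE; apply/andP/imsetP.
  case=> /asboolP/parabolic_signed_partition[d dP ->] ev; exists d => //.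
  by rewrite inE dP -irreducible_components_even.
case=> d; rewrite inE => /andP[dP ev] ->; split.
  by apply/asboolP; apply: parabolic_color_stab.
by rewrite irreducible_components_even.
Qed.

Lemma stab_inj : {in even_signed_partitions &, injective stab}.
Proof.
move=> d d'; rewrite !inE => /andP[dP _] /andP[dP' _] /(congr1 val).
exact: signed_partition_inj.
Qed.

(** Both sides satisfy the same recursion; the induction is on the order of the stabilizer. *)
Lemma mobius_PiB2 (R : realType) d : d \in even_signed_partitions ->
  (mobius (PiB2 R n) (fun K L => K \subset L) 1%G (stab d))%:~R = partition_mobius d.
Proof.
have [k] := ubnP #|stab d|; elim: k d => // k IHk d lek dE.
have := dE; rewrite inE => /andP[dP ev].
have sum1 := sum_partition_mobius ev.
have sumE : partition_mobius d +
    \sum_(d' in even_signed_partitions | (stab d' \subset stab d) && (d' != d))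
      partition_mobius d' = (stab d == 1%G)%:R.
  rewrite -val_eqE -sum1 [in RHS](bigD1 d) ?dP /=; last exact: subxx.
  congr (_ + _); rewrite [RHS](bigID (fun d' => even_coloring (partition_coloring d'))) /=.
  rewrite [X in _ = _ + X]big1 ?addr0 => [|d' /andP[/andP[/andP[dP' _] _] nev]].
    apply: eq_bigl => d'; rewrite inE; case: (is_signed_partition d') => //=.
    by rewrite andbC.
  exact: partition_mobius_eq0.
have [/eqP d1|d1] := boolP (stab d == 1%G).
  rewrite d1 mobius_refl; move: sumE; rewrite d1 eqxx big1 ?addr0 => [->//|d'].
  case/andP => dE' /andP[sub]; case/eqP; apply: stab_inj => //.
  by rewrite d1; apply/val_inj/trivgP.
have stabP : stab d \in PiB2 R n by rewrite PiB2E imset_f.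
rewrite mobius_rec //; last by rewrite eq_sym.
- move: sumE; rewrite (negPf d1) => /eqP; rewrite addr_eq0 => /eqP->.
  rewrite rmorphN /= rmorph_sum /= (PiB2E R); congr (- _).
  rewrite big_mkcondr big_imset ?[in RHS]big_mkcondr /=; last exact: stab_inj.
  apply: eq_bigr => d' dE'; rewrite -(PiB2E R) sub1G /= (inj_in_eq stab_inj) //.
  case: ifP => // /andP[sub nd]; apply: IHk => //.
  rewrite -ltnS (leq_trans _ lek) // ltnS proper_card // properEneq sub andbT.
  by apply: contra nd => /eqP/val_inj/stab_inj->.
- by move=> K L /andP[KL LK]; apply/val_inj/eqP; rewrite eqEsubset KL.
- by move=> K L M; apply: subset_trans.
Qed.

End MobiusFunction.

(** * The characteristic polynomial *)

(** The recursion unfolded; for even N its factor at a = 0 is 1, so the product can start at 1. *)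
Lemma exp_arcsinh_prod (K : comNzRingType) (q : K) N :
  exp_arcsinh q N =
    \prod_(1 <= a < (N - 2).+1 | a == N %[mod 2]) (1 - q * (a ^ 2)%:R).
Proof.
elim/ltn_ind: N => -[|[|[|[|N]]]] IHN; try by rewrite big_geq //=; ring.
  by rewrite big_ltn_cond // big_geq //=; ring.
rewrite -[LHS]/((1 - q * N.+2%:R ^+ 2) * exp_arcsinh q N.+2) IHN //.
have modS2 k : k.+2 = k %[mod 2] by rewrite -addn2 modnDr.
rewrite !subSS !subn0 !(big_mkcond (fun a => a == _ %[mod 2])) /=.
rewrite [in RHS]big_nat_recr // [in RHS]big_nat_recr //= !modS2 eqxx.
have -> : (N.+1 == N %[mod 2]) = false by rewrite !modn2 /=; case: (odd N).
by rewrite mulr1 -natrX mulrC.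
Qed.

Lemma sum_even_terms (V : zmodType) (F : nat -> V) N :
  (forall k, odd k -> F k = 0) ->
  \sum_(k < N) F k = \sum_(0 <= m < uphalf N) F (2 * m)%N.
Proof.
move=> F0; elim: N => [|N IHN]; first by rewrite big_ord0 big_geq.
rewrite big_ord_recr IHN [uphalf N.+1]/= uphalf_half.
case: (boolP (odd N)) => N_odd /=; first by rewrite F0 // addr0.
by rewrite big_nat_recr //= mul2n even_halfK.
Qed.

(** Analogue of [arcsinh'4E] with t inserted: a block with k+1 elements has 2^k sign choices and
    contributes rank k. *)
Lemma arcsinh'_scaleX k :
  arcsinh' (4%:R *: 'X) k =
    (odd_block_mobius k.+1 *: 'X^(k./2)) * (2 ^ k)%:R :> {poly rat}.
Proof.
rewrite /odd_block_mobius /=; case: ifP => [|/negbFE/arcsinh'_odd->]; last first.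
  by rewrite scale0r mul0r.
elim/ltn_ind: k => -[|[|k]] IHk //; first by rewrite /= scale1r expr0 mul1r.
rewrite /= negbK => k_even; rewrite IHk // !expnS !natrM -!mul_polyC.
rewrite !rmorphM rmorphN !rmorphM ?rmorphXn /= !rmorph_nat.
by rewrite polyC1 !exprS; ring.
Qed.

Theorem corollary2p3 (R : realType) (n : nat) (hn : (2 <= n)%N) :
  charpoly_PiB2 R n =
    \sum_(0 <= m < n./2.+1)
      ('C(n, 2 * m)%:R *
         ((4 * m)`!%:R / (2%:R ^+ (2 * m) * (2 * m).+1`!%:R))) *:
      ((- 'X) ^+ m *
       \prod_(1 <= a < (n - 2 * m - 2).+1 | a == n %[mod 2])
         (1 - (4 * a ^ 2)%:R *: 'X)).
Proof.
(* The power of t is split among the blocks: the zero block contributes |Z| to the rank and every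
   other block |B| - 1. *)
pose b k : {poly rat} := sech_arcsinh k *: 'X^(k./2).
pose a k : {poly rat} := odd_block_mobius k *: 'X^(k.-1./2).
have b0 k : odd k -> b k = 0.
  by rewrite /b /sech_arcsinh => ->; rewrite scale0r.
have a0 k : ~~ odd k -> a k = 0.
  by rewrite /a /odd_block_mobius => /negPf->; rewrite scale0r.
have weightE d : d \in even_signed_partitions n ->
    partition_mobius d *: 'X^((coxeter_rank (color_stab (partition_coloring d)))./2) =
    b #|d.1.1| * \prod_(B in d.1.2) a #|B|.
  rewrite inE => /andP[dP ev]; have [Z_even B_odd] := even_partition_coloringP dP ev.
  have [parP _] := andP dP.
  rewrite /b /a scaler_prod -scalerAl -scalerAr scalerA -expr_sum -exprD.
  congr (_ *: 'X^_).
  have := coxeter_rank_color (partition_coloring d).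
  rewrite partition_coloring_blocks //.
  have cardE : n = (#|d.1.1| + \sum_(B in d.1.2) #|B|)%N.
    by rewrite -(card_partition parP) cardsC card_ord.
  have sumE : (\sum_(B in d.1.2) #|B| =
      #|d.1.2| + (\sum_(B in d.1.2) (#|B|.-1)./2).*2)%N.
    rewrite -sum1_card -muln2 big_distrl -big_split /=; apply: eq_bigr => B /B_odd.
    by rewrite muln2; case: #|B| => //= k k_even; rewrite even_halfK.
  move: Z_even => /even_halfK ZE rankE.
  suff -> : coxeter_rank (color_stab (partition_coloring d)) =
    (#|d.1.1|./2 + \sum_(B in d.1.2) (#|B|.-1)./2).*2 by rewrite doubleK.
  by rewrite doubleD ZE; lia.
rewrite /charpoly_PiB2 PiB2E big_imset /=; last exact: stab_inj.
rewrite (eq_bigr (fun d : signed_partition n =>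
  b #|d.1.1| * \prod_(B in d.1.2) a #|B|)) => [|d dE]; last first.
  by rewrite -weightE // -(PiB2E n R) mobius_PiB2.
(* The zero coloring is fixed by the whole group, so lying below it is no restriction, and signed
   partitions outside the poset have weight 0. *)
have -> : \sum_(d in even_signed_partitions n) b #|d.1.1| * \prod_(B in d.1.2) a #|B| =
  \sum_(d | is_signed_partition d &&
     (color_stab (partition_coloring d) \subset color_stab (fun _ : 'I_n => 0)))
     b #|d.1.1| * \prod_(B in d.1.2) a #|B|.
  rewrite [RHS](bigID (fun d : signed_partition n => even_coloring (partition_coloring d))) /=.
  rewrite [X in _ + X]big1 ?addr0 => [|d /andP[/andP[dP _] ev]]; last first.
    exact: not_even_partition_weight0.
  apply: eq_bigl => d; rewrite inE.
  have -> : color_stab (partition_coloring d) \subset color_stab (fun _ : 'I_n => 0).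
    by apply/color_stabS => *; rewrite mulr0.
  by rewrite andbT.
rewrite sum_signed_partitions.
have -> : [set i : 'I_n | (0 : int) == 0] = setT by apply/setP => i; rewrite !inE.
pose E := exp_arcsinh (4%:R *: 'X : {poly rat}).
(* Every block lies in the zero block of the zero coloring, so the exponential formula applies to
   the whole complement of Z, with q = 4 t. *)
rewrite (eq_bigr (fun Z : {set 'I_n} => b #|Z| * E (#|[set: 'I_n]| - #|Z|)%N)) => [|Z _].
  rewrite (sum_subsets_card (fun k => b k * E (#|[set: 'I_n]| - k)%N)) cardsT card_ord.
  rewrite (sum_even_terms (F := fun k => 'C(n, k)%:R * (b k * E (n - k)%N))) => [|k /b0->].
    apply: eq_big_nat => m /andP[_ mn].
    rewrite /b mul2n doubleK -mul2n sech_arcsinhE /E exp_arcsinh_prod.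
    have le2mn : (2 * m <= n)%N by move: mn; rewrite /= ltnS; lia.
    have -> : \prod_(1 <= a < (n - 2 * m - 2).+1 | a == n - 2 * m %[mod 2])
        (1 - 4%:R *: 'X * (a ^ 2)%:R) =
      \prod_(1 <= a < (n - 2 * m - 2).+1 | a == n %[mod 2])
        (1 - (4 * a ^ 2)%:R *: 'X) :> {poly rat}.
      apply: eq_big => [k|k _].
        by rewrite -[X in _ = (_ == X %% _)%N](subnKC le2mn) mulnC modnMDl.
      by rewrite mulr_natr natrM [4%:R * _]mulrC -scalerA !scaler_nat.
    rewrite -(mulrA ((-1) ^+ m)) (exprNn ('X : {poly rat})).
    move: (_ / _) (\prod_(_ <= _ < _ | _) _) => u p.
    rewrite -!mul_polyC !rmorphM rmorph_nat rmorph_sign /=; ring.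
  by rewrite mul0r mulr0.
congr (_ * _).
rewrite -cardsDS ?subsetT // setTD; apply: (partition_sum_card (g := arcsinh' (4%:R *: 'X))) => //.
  exact: exp_arcsinhS.
move=> B _ B0; rewrite sign_count_zero // arcsinh'_scaleX /a.
by rewrite prednK // lt0n cards_eq0.
Qed.
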